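(* Let $N$ be a simply connected two-step nilpotent Lie group of dimension five with a left invariant Riemannian metric $g$, whose Lie algebra $\mathfrak{n}$ has three-dimensional center, and let $\{e_1,e_2,e_3,e_4,e_5\}$ be an orthonormal basis of $\mathfrak{n}$ such that $[e_1,e_2]=\lambda e_3$ with $\lambda>0$, all other brackets of basis vectors (up to skew-symmetry) vanish, and $\{e_3,e_4,e_5\}$ is a basis of the center. Let $Q=q_1e_4+q_2e_5$ with $q_1,q_2\in\mathbb{R}$ and $0<\sqrt{q_1^2+q_2^2}<1$, regarded as a left invariant vector field on $N$, and let $F$ be the Randers metric $F(x,Y)=\sqrt{g(x)(Y,Y)}+g(x)(Q(x),Y)$. Let $P\subset T_eN$ be a two-dimensional subspace, let $A=ae_1+be_2+ce_3+de_4+fe_5\in P$ be a vector of $g$-length one, and let $B$ be any vector in $P$ such that $\{A,B\}$ is a $g$-orthonormal basis of $P$. Then the flag curvature of $F$ for the flag $(P,A)$ is $$K(P,A)=\frac{K^R(A,B)}{(1+q_1d+q_2f)^2},$$ where $K^R(A,B)$ is the sectional curvature of $g$ for the plane $\mathrm{span}\{A,B\}$.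
   Context: Here $e$ is the unit element of $N$ and $\mathfrak{n}=T_eN$. A Lie group is two-step nilpotent if its Lie algebra is non-abelian and $[\mathfrak{n},[\mathfrak{n},\mathfrak{n}]]=0$. By a known classification, an orthonormal basis of the stated form always exists when the center is three-dimensional. The flag curvature of a Finsler metric $F$ for a plane $P=\mathrm{span}\{U,Y\}$ in a tangent space and flagpole $Y\neq0$ is $$K(P,Y)=\frac{g_Y(R(U,Y)Y,U)}{g_Y(Y,Y)\,g_Y(U,U)-g_Y^2(Y,U)},$$ where $g_Y(U,V)=\frac12\frac{\partial^2}{\partial s\,\partial t}F^2(Y+sU+tV)\big|_{s=t=0}$, $R(U,Y)Y=\nabla_U\nabla_YY-\nabla_Y\nabla_UY-\nabla_{[U,Y]}Y$, and $\nabla$ is the Chern connection of $F$. A Randers metric defined by $g$ and a vector field $X$ is of Berwald type if and only if $X$ is parallel for the Levi-Civita connection of $g$, and for such a metric the Chern connection coincides with the Levi-Civita connection of $g$. The field $Q$ in the claim is parallel with respect to the Levi-Civita connection of $g$, so $F$ is of Berwald type. *)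

(* Defs.v *)
From HB Require Import structures.
From mathcomp Require Import all_boot all_order all_algebra.
From mathcomp Require Import all_classical all_reals all_analysis.

Set Implicit Arguments.
Unset Strict Implicit.
Unset Printing Implicit Defensive.

Import Order.TTheory GRing.Theory Num.Theory.
Import numFieldNormedType.Exports.

Local Open Scope classical_set_scope.
Local Open Scope ring_scope.

(* * Linear algebra in a real vector space *)

Definition lin_span (R : realType) (V : lmodType R) (s : seq V) : set V :=
  [set v | exists a : 'I_(size s) -> R, v = \sum_i a i *: s`_i].

Definition lin_indep (R : realType) (V : lmodType R) (s : seq V) : Prop :=
  forall a : 'I_(size s) -> R, \sum_i a i *: s`_i = 0 -> forall i, a i = 0.

Definition is_basis (R : realType) (V : lmodType R) (S : set V) (s : seq V) :
    Prop :=
  S = lin_span s /\ lin_indep s.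

Definition is_orthonormal (R : realType) (V : lmodType R) (b : V -> V -> R)
    (s : seq V) : Prop :=
  forall i j, (i < size s)%N -> (j < size s)%N -> b s`_i s`_j = (i == j)%:R.

(* * Smooth maps between normed spaces *)

(* Only meant for open [O]. *)
Fixpoint Ck (R : realType) (E F : normedModType R) (k : nat) (O : set E)
    (f : E -> F) : Prop :=
  match k with
  | 0 => forall x, O x -> {for x, continuous f}
  | k'.+1 => (forall x, O x -> differentiable f x) /\
             (forall v : E, Ck k' O ('D_v f))
  end.

Definition smooth_on (R : realType) (E F : normedModType R) (O : set E)
    (f : E -> F) : Prop :=
  forall k, Ck k O f.

(* * Smooth manifolds *)

Record chart (R : realType) (n : nat) (M : topologicalType) := Chart {
  chart_dom : set M;
  chart_map : M -> 'rV[R]_n;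
  chart_inv : 'rV[R]_n -> M
}.

Definition chart_cod (R : realType) (n : nat) (M : topologicalType)
    (c : chart R n M) : set 'rV[R]_n :=
  chart_map c @` chart_dom c.

Definition is_chart (R : realType) (n : nat) (M : topologicalType)
    (c : chart R n M) : Prop :=
  [/\ open (chart_dom c), open (chart_cod c),
      forall p, chart_dom c p -> chart_inv c (chart_map c p) = p,
      forall p, chart_dom c p -> {for p, continuous (chart_map c)} &
      forall x, chart_cod c x -> {for x, continuous (chart_inv c)}].

Definition compatible_charts (R : realType) (n : nat) (M : topologicalType)
    (c c' : chart R n M) : Prop :=
  smooth_on (chart_map c @` (chart_dom c `&` chart_dom c'))
            (chart_map c' \o chart_inv c).

Record manifold (R : realType) (n : nat) := Manifold {
  mf_space :> topologicalType;
  atlas : set (chart R n mf_space);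
  mf_hausdorff : hausdorff_space mf_space;
  mf_second_countable : @second_countable mf_space;
  atlas_chart : forall c, atlas c -> is_chart c;
  atlas_cover : forall p : mf_space, exists2 c, atlas c & chart_dom c p;
  atlas_compatible : forall c c', atlas c -> atlas c' -> compatible_charts c c'
}.

Definition smooth_fun (R : realType) (n : nat) (M : manifold R n)
    (f : M -> R) : Prop :=
  forall c, @atlas R n M c -> smooth_on (chart_cod c) (f \o chart_inv c).

Definition simply_connected (R : realType) (M : topologicalType) : Prop :=
  (forall x y : M, exists gamma : R -> M,
     [/\ {within `[0, 1], continuous gamma}, gamma 0 = x & gamma 1 = y]) /\
  (forall gamma : R -> M,
     {within `[0, 1], continuous gamma} -> gamma 0 = gamma 1 ->
     exists H : R * R -> M,
       [/\ {within `[0, 1] `*` `[0, 1], continuous H},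
           forall t : R, t \in `[0, 1] -> H (0, t) = gamma t,
           forall t : R, t \in `[0, 1] -> H (1, t) = gamma 0 &
           forall s : R, s \in `[0, 1] ->
             H (s, 0) = gamma 0 /\ H (s, 1) = gamma 0]).

(* * Tangent vectors and vector fields *)

(* A tangent vector at [p] is a derivation at [p] of the algebra of smooth
   functions. It is extended by 0 to the functions that are not smooth, so that
   equality of tangent vectors is Leibniz equality and the tangent space at [p]
   is a linear subspace of the vector space of all functionals. *)
Definition functional (R : realType) (n : nat) (M : manifold R n) : Type :=
  (M -> R) -> R.

Definition tangent (R : realType) (n : nat) (M : manifold R n) (p : M) :
    set (functional M) :=
  [set v : functional M |
    [/\ forall (a : R) (f h : M -> R), smooth_fun f -> smooth_fun h ->
          v (fun q => a * f q + h q) = a * v f + v h,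
        forall f h : M -> R, smooth_fun f -> smooth_fun h ->
          v (fun q => f q * h q) = f p * v h + h p * v f &
        forall f : M -> R, ~ smooth_fun f -> v f = 0]].

Definition vfield (R : realType) (n : nat) (M : manifold R n) : Type :=
  M -> functional M.

Definition smooth_vfield (R : realType) (n : nat) (M : manifold R n)
    (X : vfield M) : Prop :=
  (forall p, tangent p (X p)) /\
  (forall f, smooth_fun f -> smooth_fun (fun p => X p f)).

Definition nonvanishing (R : realType) (n : nat) (M : manifold R n)
    (X : vfield M) : Prop :=
  forall p, X p <> 0.

Definition fscale (R : realType) (n : nat) (M : manifold R n)
    (f : M -> R) (X : vfield M) : vfield M :=
  fun p => f p *: X p.

Definition bracket (R : realType) (n : nat) (M : manifold R n)
    (X Y : vfield M) : vfield M :=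
  fun p f => X p (fun q => Y q f) - Y p (fun q => X q f).

(* * Affine connections *)

Definition connection (R : realType) (n : nat) (M : manifold R n) : Type :=
  vfield M -> vfield M -> vfield M.

Definition affine_connection (R : realType) (n : nat) (M : manifold R n)
    (D : connection M) : Prop :=
  [/\ forall X Y, smooth_vfield X -> smooth_vfield Y -> smooth_vfield (D X Y),
      forall f X X' Y, smooth_fun f -> smooth_vfield X -> smooth_vfield X' ->
        smooth_vfield Y -> D (fscale f X + X') Y = fscale f (D X Y) + D X' Y,
      forall X Y Y', smooth_vfield X -> smooth_vfield Y -> smooth_vfield Y' ->
        D X (Y + Y') = D X Y + D X Y' &
      forall f X Y, smooth_fun f -> smooth_vfield X -> smooth_vfield Y ->
        D X (fscale f Y) = fscale (fun p => X p f) Y + fscale f (D X Y)].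

Definition torsion_free (R : realType) (n : nat) (M : manifold R n)
    (D : connection M) : Prop :=
  forall X Y, smooth_vfield X -> smooth_vfield Y -> D X Y - D Y X = bracket X Y.

Definition curvature (R : realType) (n : nat) (M : manifold R n)
    (D : connection M) (U V Z : vfield M) : vfield M :=
  D U (D V Z) - D V (D U Z) - D (bracket U V) Z.

(* * Riemannian metrics *)

Definition metric (R : realType) (n : nat) (M : manifold R n) : Type :=
  M -> functional M -> functional M -> R.

Definition riemannian (R : realType) (n : nat) (M : manifold R n)
    (g : metric M) : Prop :=
  [/\ forall p (a : R) u v w, tangent p u -> tangent p v -> tangent p w ->
        g p (a *: u + v) w = a * g p u w + g p v w,
      forall p u v, tangent p u -> tangent p v -> g p u v = g p v u,
      forall p u, tangent p u -> u <> 0 -> 0 < g p u u &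
      forall X Y, smooth_vfield X -> smooth_vfield Y ->
        smooth_fun (fun p => g p (X p) (Y p))].

Definition levi_civita (R : realType) (n : nat) (M : manifold R n)
    (g : metric M) (D : connection M) : Prop :=
  [/\ affine_connection D, torsion_free D &
      forall X Y Z p, smooth_vfield X -> smooth_vfield Y -> smooth_vfield Z ->
        X p (fun q => g q (Y q) (Z q)) =
        g p (D X Y p) (Z p) + g p (Y p) (D X Z p)].

(* [k] is the sectional curvature of the plane [P] at [p]: the quotient takes
   the value [k], and only this value, when [(U, V)] runs over the pairs of
   smooth vector fields whose values at [p] form a basis of [P]. *)
Definition is_sectional_curvature (R : realType) (n : nat) (M : manifold R n)
    (g : metric M) (D : connection M) (p : M) (P : set (functional M)) (k : R) :
    Prop :=
  [set r : R | exists U V : vfield M,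
     [/\ smooth_vfield U, smooth_vfield V, is_basis P [:: U p; V p] &
         r = g p (curvature D U V V p) (U p) /
             (g p (V p) (V p) * g p (U p) (U p) - g p (V p) (U p) ^+ 2)]] =
  [set k].

(* * Finsler metrics *)

Definition finsler (R : realType) (n : nat) (M : manifold R n) : Type :=
  M -> functional M -> R.

Definition fundamental_tensor (R : realType) (n : nat) (M : manifold R n)
    (F : finsler M) (p : M) (y u v : functional M) : R :=
  2^-1 * derive1 (fun s : R =>
    derive1 (fun t : R => F p (y + s *: u + t *: v) ^+ 2) 0) 0.

Definition cartan_tensor (R : realType) (n : nat) (M : manifold R n)
    (F : finsler M) (p : M) (y u v w : functional M) : R :=
  4^-1 * derive1 (fun r : R => derive1 (fun s : R =>
    derive1 (fun t : R => F p (y + r *: u + s *: v + t *: w) ^+ 2) 0) 0) 0.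

(* The Chern connection, as the family of affine connections [nab V] with
   nowhere vanishing reference field [V]: for each [V] it is the only affine
   connection that is torsion-free and almost compatible with the metric,
     X(g_V(Y, Z)) = g_V(nab X Y, Z) + g_V(Y, nab X Z) + 2 C_V(nab X V, Y, Z). *)
Definition chern_connection (R : realType) (n : nat) (M : manifold R n)
    (F : finsler M) (nab : vfield M -> connection M) : Prop :=
  forall V, smooth_vfield V -> nonvanishing V ->
  [/\ affine_connection (nab V), torsion_free (nab V) &
      forall X Y Z p, smooth_vfield X -> smooth_vfield Y -> smooth_vfield Z ->
        X p (fun q => fundamental_tensor F q (V q) (Y q) (Z q)) =
        fundamental_tensor F p (V p) (nab V X Y p) (Z p) +
        fundamental_tensor F p (V p) (Y p) (nab V X Z p) +
        2 * cartan_tensor F p (V p) (nab V X V p) (Y p) (Z p)].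

(* [k] is the flag curvature of the flag [(P, y)] at [p]: the quotient takes the
   value [k], and only this value, when [Y] runs over the nowhere vanishing
   smooth fields extending [y], used both as flagpole and as reference field of
   the Chern connection, and [U] over the smooth fields such that
   [P = span {U, Y}] at [p]. Independence of the extension [Y] holds for metrics
   of Berwald type; for other Finsler metrics the quotient is the usual flag
   curvature only for those [Y] with [nab Y Y Y p = 0]. *)
Definition is_flag_curvature (R : realType) (n : nat) (M : manifold R n)
    (F : finsler M) (nab : vfield M -> connection M) (p : M)
    (P : set (functional M)) (y : functional M) (k : R) : Prop :=
  [set r : R | exists U Y : vfield M,
     [/\ smooth_vfield U, smooth_vfield Y, nonvanishing Y,
         Y p = y /\ is_basis P [:: U p; Y p] &
         let gY := fundamental_tensor F p (Y p) in
         r = gY (curvature (nab Y) U Y Y p) (U p) /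
             (gY (Y p) (Y p) * gY (U p) (U p) - gY (Y p) (U p) ^+ 2)]] =
  [set k].

Definition randers (R : realType) (n : nat) (M : manifold R n)
    (g : metric M) (X : vfield M) : finsler M :=
  fun p y => Num.sqrt (g p y y) + g p (X p) y.

(* * Lie groups *)

Definition smooth_mul (R : realType) (n : nat) (M : manifold R n)
    (mul : M -> M -> M) : Prop :=
  continuous (fun x : M * M => mul x.1 x.2) /\
  forall c1 c2 c3, @atlas R n M c1 -> @atlas R n M c2 -> @atlas R n M c3 ->
  smooth_on
    [set x : 'rV[R]_n * 'rV[R]_n | [/\ chart_cod c1 x.1, chart_cod c2 x.2 &
       chart_dom c3 (mul (chart_inv c1 x.1) (chart_inv c2 x.2))]]
    (fun x => chart_map c3 (mul (chart_inv c1 x.1) (chart_inv c2 x.2))).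

Definition smooth_inv (R : realType) (n : nat) (M : manifold R n)
    (inv : M -> M) : Prop :=
  continuous inv /\
  forall c1 c2, @atlas R n M c1 -> @atlas R n M c2 ->
  smooth_on
    [set x | chart_cod c1 x /\ chart_dom c2 (inv (chart_inv c1 x))]
    (fun x => chart_map c2 (inv (chart_inv c1 x))).

Record lie_group (R : realType) (n : nat) := LieGroup {
  lg_manifold :> manifold R n;
  lg_mul : lg_manifold -> lg_manifold -> lg_manifold;
  lg_inv : lg_manifold -> lg_manifold;
  lg_one : lg_manifold;
  lg_mulA : associative lg_mul;
  lg_mul1g : left_id lg_one lg_mul;
  lg_mulVg : left_inverse lg_one lg_inv lg_mul;
  lg_smooth_mul : smooth_mul lg_mul;
  lg_smooth_inv : smooth_inv lg_inv
}.

(* The differential of the left translation by [x]. *)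
Definition dleft (R : realType) (n : nat) (N : lie_group R n) (x : N)
    (v : functional N) : functional N :=
  fun f => v (fun q => f (lg_mul x q)).

Definition left_invariant_metric (R : realType) (n : nat) (N : lie_group R n)
    (g : metric N) : Prop :=
  forall x p u v, tangent p u -> tangent p v ->
    g (lg_mul x p) (dleft x u) (dleft x v) = g p u v.

(* The Lie algebra, as the space of left invariant vector fields; evaluation at
   the unit identifies it with the tangent space at the unit. *)
Definition lie_algebra (R : realType) (n : nat) (N : lie_group R n) :
    set (vfield N) :=
  [set X | smooth_vfield X /\
           forall x p : N, X (lg_mul x p) = dleft x (X p)].

Arguments lie_algebra {R n} N.

Definition lie_center (R : realType) (n : nat) (N : lie_group R n) :
    set (vfield N) :=
  [set Z | lie_algebra N Z /\ forall X, lie_algebra N X -> bracket X Z = 0].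

Arguments lie_center {R n} N.

Definition two_step_nilpotent (R : realType) (n : nat) (N : lie_group R n) :
    Prop :=
  (exists X Y : vfield N,
     [/\ lie_algebra N X, lie_algebra N Y & bracket X Y <> 0]) /\
  (forall X Y Z : vfield N,
     lie_algebra N X -> lie_algebra N Y -> lie_algebra N Z ->
     bracket X (bracket Y Z) = 0).

(* Main.v *)
From HB Require Import structures.
Require Import Defs.
From mathcomp Require Import all_boot all_order all_algebra.
From mathcomp Require Import all_classical all_reals all_analysis.
From mathcomp Require Import ring lra.
Set Implicit Arguments.
Unset Strict Implicit.
Unset Printing Implicit Defensive.
Import Order.TTheory GRing.Theory Num.Theory.
Import numFieldNormedType.Exports.
Local Open Scope classical_set_scope.
Local Open Scope ring_scope.

(** Why the formula holds. Write [alpha] for the norm of [g], [beta] for the form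
    dual to [Q], so that [F = alpha + beta]. The field [Q] is parallel for the
    Levi-Civita connection [D] of [g], hence [F] is of Berwald type and its Chern
    connection is [D] for every reference field. The flag curvature is therefore
    a quotient of values of the fundamental tensor on the Riemannian curvature
    vector [W = R(U, Y)Y]. That tensor is
    [g_Y(u, v) = dF_Y(u) dF_Y(v) + F(Y) h_Y(u, v)], where [h_Y] is the Hessian of
    [alpha]. The vector [W] is orthogonal to [Y] because [D] is metric
    ([curvature_skew]) and to [Q] because [Q] is parallel
    ([curvature_parallel]); thus [dF_Y(W) = 0], and for [Y] of length one the
    numerator is [F] times the Riemannian one, while the denominator is [F^3]
    times the Riemannian one ([randers_flag_quotient]). The quotient is
    [K^R / F^2], and [F(A) = 1 + q1 d + q2 f].

    Parallelism of [Q]. The Koszul formula on the orthonormal left invariant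
    frame gives [D e_i e_4 = D e_i e_5 = 0], since [e_4] and [e_5] are central and
    orthogonal to the brackets ([central_parallel]). To replace [e_i] by an
    arbitrary smooth field one has to expand that field on the frame, so one has
    to know that five orthonormal tangent vectors span the tangent space. Tangent
    vectors being derivations of the algebra of global smooth functions, this
    bound on the dimension ([tangent_dependent]) is where analysis enters: it
    rests on the lemma of Hadamard ([hadamard]), obtained by differentiation
    under the integral sign, and on smooth bump functions
    ([smooth_chart_extend], [smooth_bump]).

    Identification of the Chern connection. The fundamental and Cartan tensors
    have closed forms ([fundamental_tensor_randers], [cartan_tensor_randers]),
    from which [D] is seen to satisfy the axioms of the Chern connection
    ([levi_civita_randers]). These axioms determine the connection, because the
    fundamental tensor is definite when [Q] is shorter than one
    ([chern_connection_berwald]). *)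

(** * Calculus of maps of class C^k *)

Section CkCalculus.
Context {R : realType}.
Implicit Types E F G : normedModType R.

(** Fréchet differentiability from an epsilon estimate against a candidate
    differential; it avoids manipulating little-o expressions. *)
Lemma differentiable_eps E F (f : E -> F) (x : E) (L : {linear E -> F}) :
  continuous L ->
  (forall e : R, 0 < e ->
     \forall h \near 0, `|f (h + x) - f x - L h| <= e * `|h|) ->
  differentiable f x /\ 'd f x = L :> (E -> F).
Proof.
move=> cL fL.
have fo : f \o shift x = cst (f x) + L +o_ 0 id.
  apply/eqaddoP => e e0; apply: filterS (fL e e0) => h /=.
  by rewrite opprD addrA.
have dE := diff_unique cL fo; split=> //.
by apply/diff_locallyP; rewrite dE.
Qed.

Lemma differentiable_near_eq E F (f g : E -> F) (x : E) :
  (\forall y \near x, f y = g y) -> differentiable f x -> differentiable g x.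
Proof.
move=> fg df; apply: (differentiable_eps (L := 'd f x) _ _).1.
  exact: diff_continuous.
move=> e e0.
have /diff_locallyP[_ /eqaddoP/(_ e e0)] := df.
have : \forall h \near (0 : E), (f (h + x) = g (h + x)).
  by move: fg; rewrite (near_shift 0 x)/= => fg; apply: filterS fg => h; rewrite /= subr0.
apply: filterS2 => h; rewrite /= => <-.
by rewrite -(nbhs_singleton fg) /= opprD addrA.
Qed.

Lemma open_near E (O : set E) (P : E -> Prop) (x : E) :
  open O -> O x -> (forall y, O y -> P y) -> \forall y \near x, P y.
Proof. by move=> oO Ox OP; apply: filterS (open_nbhs_nbhs (conj oO Ox)). Qed.

(** [Ck] involves the values of the function outside [O] only through germs at
    points of [O], so on an open [O] those values are irrelevant. *)
Lemma Ck_ext E F k (O : set E) (f g : E -> F) : open O ->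
  (forall x, O x -> f x = g x) -> Ck k O f -> Ck k O g.
Proof.
move=> oO; elim: k f g => [|k IH] f g fg /=.
  move=> cf x Ox; have nfg := open_near oO Ox fg.
  rewrite /prop_for /continuous_at -(fg x Ox).
  exact: cvg_trans (near_eq_cvg nfg) (cf x Ox).
move=> [df Df]; split=> [x Ox|v].
  by apply: differentiable_near_eq (df x Ox); apply: open_near fg.
apply: IH (Df v) => x Ox; apply: near_eq_derive; exact: open_near fg.
Qed.

Lemma Ck_sub E F k (O O' : set E) (f : E -> F) :
  O' `<=` O -> Ck k O f -> Ck k O' f.
Proof.
move=> OO'; elim: k f => [|k IH] f /= ; first by move=> cf x /OO'/cf.
by move=> [df Df]; split=> [x /OO'/df//|v]; exact: IH.
Qed.

Lemma Ck_local E F k (O : set E) (f : E -> F) :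
  (forall x, O x -> exists2 U : set E, U x & Ck k U f) -> Ck k O f.
Proof.
elim: k f => [|k IH] f Of /=; first by move=> x /Of [U Ux cf]; exact: cf.
split=> [x /Of [U Ux [df _]]|v]; first exact: df.
by apply: IH => x /Of [U Ux [_ Df]]; exists U; last exact: Df.
Qed.

Lemma CkS E F k (O : set E) (f : E -> F) : Ck k.+1 O f -> Ck k O f.
Proof.
elim: k f => [|k IH] f [df Df].
  by move=> x Ox; apply: differentiable_continuous; exact: df.
by split=> // v; apply: IH; exact: Df.
Qed.

Lemma Ck_cst E F k (O : set E) (c : F) : Ck k O (cst c : E -> F).
Proof.
elim: k c => [|k IH] c; first by move=> x _; exact: cst_continuous.
split=> [x _|v]; first exact: differentiable_cst.
rewrite (_ : 'D_v _ = cst 0); first exact: IH.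
by apply/funext => x; rewrite derive_cst.
Qed.

Lemma CkD E F k (O : set E) (f g : E -> F) : open O ->
  Ck k O f -> Ck k O g -> Ck k O (fun x => f x + g x).
Proof.
move=> oO; elim: k f g => [|k IH] f g.
  by move=> cf cg x Ox; apply: continuousD; [exact: cf|exact: cg].
move=> [df Df] [dg Dg]; split=> [x Ox|v].
  by apply: differentiableD; [exact: df|exact: dg].
apply: Ck_ext (IH _ _ (Df v) (Dg v)) => // x Ox.
by apply/esym/(@deriveD _ _ _ f g); apply: diff_derivable; [exact: df|exact: dg].
Qed.

Lemma CkM E k (O : set E) (f g : E -> R) : open O ->
  Ck k O f -> Ck k O g -> Ck k O (fun x => f x * g x).
Proof.
move=> oO; elim: k f g => [|k IH] f g.
  by move=> cf cg x Ox; apply: continuousM; [exact: cf|exact: cg].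
move=> Cf Cg; have [[df Df] [dg Dg]] := (Cf, Cg); split=> [x Ox|v].
  by apply: differentiableM; [exact: df|exact: dg].
apply: Ck_ext (CkD oO (IH _ _ (CkS Cf) (Dg v)) (IH _ _ (CkS Cg) (Df v))) => // x Ox.
by apply/esym/(@deriveM _ _ f g); apply: diff_derivable; [exact: df|exact: dg].
Qed.

Lemma Ck_sum E k (O : set E) n (f : 'I_n -> E -> R) : open O ->
  (forall i, Ck k O (f i)) -> Ck k O (fun x => \sum_i f i x).
Proof.
move=> oO; elim: n f => [|n IH] f Cf.
  rewrite (_ : (fun _ => _) = cst 0); first exact: Ck_cst.
  by apply/funext => x; rewrite big_ord0.
rewrite (_ : (fun _ => _) =
  fun x => (\sum_(i < n) f (widen_ord (leqnSn n) i) x) + f ord_max x).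
  by apply: CkD => //; exact: IH.
by apply/funext => x; rewrite big_ord_recr.
Qed.

Lemma Ck_coord E n k (O : set E) (f : E -> 'rV[R]_n) (i : 'I_n) : open O ->
  Ck k O f -> Ck k O (fun x => f x 0 i).
Proof.
move=> oO; elim: k f => [|k IH] f.
  move=> cf x Ox; apply: (@continuous_comp _ _ _ f (fun N : 'rV[R]_n => N 0 i) x (cf x Ox)); exact: coord_continuous.
move=> [df Df]; have dc x : O x ->
    differentiable (fun x => f x 0 i) x /\
    'd (fun x => f x 0 i) x = (fun v => 'd f x v 0 i) :> (E -> R).
  move=> Ox; have dcoord := @differentiable_coord R 1 n (f x) 0 i.
  have fE : (fun x => f x 0 i) = (fun N : 'rV[R]_n => N 0 i) \o f by [].
  split; rewrite fE; first by apply: differentiable_comp => //; exact: df.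
  rewrite diff_comp //; last exact: df.
  apply/funext => v /=.
  have @l : {linear 'rV[R]_n -> R}.
    by exists (fun N : 'rV[R]_n => N 0 i); do 2![eexists]; do ?[constructor];
     rewrite ?mxE// => ? *; rewrite ?mxE//; move=> ?; rewrite !mxE.
  have -> : (fun N : 'rV[R]_n => N 0 i) = l by [].
  by rewrite (diff_lin _ _) //=; exact: coord_continuous.
split=> [x /dc[]//|v].
apply: Ck_ext (IH _ (Df v)) => // x Ox.
have [dx dE] := dc x Ox.
by rewrite [RHS]deriveE // dE deriveE //; exact: df.
Qed.

Lemma derive_rV n (u : 'rV[R]_n -> R) x v : differentiable u x ->
  'D_v u x = \sum_i 'D_(delta_mx 0 i) u x * v 0 i.
Proof.
move=> du; rewrite deriveE // {1}(row_sum_delta v) linear_sum.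
by apply: eq_bigr => i _; rewrite linearZ /= mulrC deriveE.
Qed.

(** Chain rule. The direction [D_v f x] in which [u] is differentiated varies
    with [x], so it is expanded on the standard basis: this writes the
    derivative of [u \o f] as a sum of products to which the induction
    hypothesis applies. *)
Lemma Ck_comp E n k (O : set E) (O' : set 'rV[R]_n)
    (f : E -> 'rV[R]_n) (u : 'rV[R]_n -> R) : open O ->
  (forall x, O x -> O' (f x)) ->
  Ck k O f -> Ck k O' u -> Ck k O (u \o f).
Proof.
move=> oO fO; elim: k u => [|k IH] u.
  by move=> cf cu x Ox; apply: continuous_comp; [exact: cf|exact/cu/fO].
move=> Cf [du Du]; have [df Df] := Cf; split=> [x Ox|v].
  by apply: differentiable_comp; [exact: df|exact/du/fO].
apply: (@Ck_ext _ _ _ _ (fun x =>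
  \sum_i ('D_(delta_mx 0 i) u \o f) x * ('D_v f x) 0 i)) => // [x Ox|].
  rewrite [RHS]deriveE; last by apply: differentiable_comp; [exact: df|exact/du/fO].
  rewrite diff_comp //; [|exact: df|exact/du/fO].
  by rewrite /= -deriveE ?derive_rV; [rewrite deriveE//; exact: df|exact/du/fO..].
apply: Ck_sum => // i; apply: CkM => //.
  by apply: IH (CkS Cf) _; exact: Du.
by apply: Ck_coord => //; exact: Df.
Qed.

Lemma Ck_comp1 E k (O : set E) (O' : set R) (f : E -> R) (u : R -> R) :
  open O -> (forall x, O x -> O' (f x)) ->
  Ck k O f -> Ck k O' u -> Ck k O (u \o f).
Proof.
move=> oO fO; elim: k u => [|k IH] u.
  by move=> cf cu x Ox; apply: continuous_comp; [exact: cf|exact/cu/fO].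
move=> Cf [du Du]; have [df Df] := Cf; split=> [x Ox|v].
  by apply: differentiable_comp; [exact: df|exact/du/fO].
apply: (@Ck_ext _ _ _ _ (fun x =>
  ('D_1 u \o f) x * 'D_v f x)) => // [x Ox|].
  have duf := du _ (fO _ Ox).
  rewrite [RHS]deriveE; last by apply: differentiable_comp => //; exact: df.
  rewrite diff_comp //; last exact: df.
  rewrite /= -(deriveE _ (df x Ox)) deriveE //.
  by rewrite -{2}['D_v f x]mulr1 [RHS]linearZ /= [RHS]mulrC.
by apply: CkM => //; [apply: IH (CkS Cf) _; exact: Du|exact: Df].
Qed.

End CkCalculus.

(** * Smooth functions of one variable: powers and a flat function *)

Section OneVariable.
Context {R : realType}.

Lemma Ck_derive1 k (O : set R) (u u' : R -> R) : open O ->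
  (forall x, O x -> is_derive x 1 u (u' x)) -> Ck k O u' -> Ck k.+1 O u.
Proof.
move=> oO uu' Cu'.
have du x : O x -> differentiable u x.
  by move=> Ox; apply/derivable1_diffP; have [] := uu' x Ox.
split=> // v; apply: (@Ck_ext _ _ _ _ _ (fun x => cst v x * u' x)) => //.
  move=> x Ox; have [_ <-] := uu' x Ox.
  rewrite !deriveE; try exact: du.
  by rewrite -[in RHS](mulr1 v) linearZ.
by apply: CkM => //; exact: Ck_cst.
Qed.

Lemma Ck_powR k (a : R) : Ck k [set t : R | 0 < t] (fun t => t `^ a).
Proof.
have oP : open [set t : R | 0 < t] by exact: open_gt.
elim: k a => [|k IH] a.
  move=> x /= x0; apply/differentiable_continuous/derivable1_diffP.
  by have [] := is_derive1_powR a x0.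
apply: (@Ck_derive1 _ _ _ (fun t => cst a t * t `^ (a - 1))) => //.
by apply: CkM => //; exact: Ck_cst.
Qed.

(** The powers of [1/t] are there so that the family is closed under
    derivation; [flat 0] is the usual function exp(-1/t), extended by 0 to the
    left, which is smooth and flat at 0. *)
Definition flat n (t : R) : R :=
  if 0 < t then t^-1 ^+ n * expR (- t^-1) else 0.

(** The exponential beats every power of [1/t], by the term of order [n + 2]
    of its series. The bound is quadratic so that it gives the derivative 0 at
    the origin. *)
Lemma flat_le n (t : R) : `|flat n t| <= (n.+2)`!%:R * t ^+ 2.
Proof.
rewrite /flat; case: ifP => [t0|_]; last first.
  by rewrite normr0 mulr_ge0 // sqr_ge0.
have s0 : 0 < t^-1 by rewrite invr_gt0.
rewrite ger0_norm; last by rewrite mulr_ge0 ?expR_ge0 // exprn_ge0 // ltW.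
rewrite -[X in _ * X ^+ 2]invrK; move: (t^-1) s0 => {t0} s s0.
have le1 := expR_ge1Dxn n.+1 (ltW s0).
rewrite expRN exprVn.
rewrite ler_pdivrMr ?expR_gt0 // mulrAC ler_pdivlMr ?exprn_gt0 // -exprD addn2.
have f0 : 0 < (n.+2)`!%:R :> R by rewrite ltr0n fact_gt0.
rewrite mulrC -ler_pdivrMr //; apply: le_trans le1.
by rewrite lerDr.
Qed.

(** On the right of 0 this is the usual rule, on the left the function is
    constant, and at 0 it follows from the quadratic bound. *)
Lemma is_derive_flat n (t : R) :
  is_derive t 1 (flat n) (flat n.+2 t - n%:R * flat n.+1 t).
Proof.
have [t0|t0|<-] := ltgtP 0 t.
- have near_pos : \forall s \near t, ((s^-1 ^+ n * expR (- s^-1)) = flat n s).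
    apply: (@open_near R R [set s : R | 0 < s] _ _ (@open_gt R 0) t0) => s /= s0.
    by rewrite /flat s0.
  apply: near_eq_is_derive near_pos _.
  have dV : is_derive t 1 (fun s : R => s^-1) (- t ^- 2).
    split; first by apply: derivableV => //; rewrite gt_eqF.
    by rewrite deriveV ?gt_eqF // derive_id [LHS]mulr1.
  have dE := @is_derive1_comp _ expR (fun s => - s^-1) t _ _
    (is_derive_expR _) (is_deriveN dV).
  have dX := is_deriveX n dV; rewrite exprfctE in dX.
  apply: is_derive_eq (is_deriveM dX dE) _.
   rewrite /flat t0 -exprVn /= -!/(_ * _).
  rewrite /GRing.scale /=; move: (t^-1) (expR _) => s E; clear.
  by case: n => [|n]; rewrite /= !exprS ?expr0; ring.
- have near_neg : \forall s \near t, (cst 0 s = flat n s).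
    apply: (@open_near R R [set s : R | s < 0] _ _ (@open_lt R 0) t0) => s /= s0.
    by rewrite /flat ltNge ltW.
  apply: near_eq_is_derive near_neg _.
  rewrite /flat ltNge ltW //= mulr0 subr0; exact: is_derive_cst.
- have [] := @differentiable_eps R R R (flat n) 0 (\0 : {linear R -> R}).
  + exact: cst_continuous.
  + move=> e e0; have f0 : 0 < (n.+2)`!%:R :> R by rewrite ltr0n fact_gt0.
    near=> h; rewrite addr0 {2}/flat ltxx /= !subr0.
    apply: le_trans (flat_le n h) _; rewrite -real_normK ?num_real // expr2 mulrA.
    apply: ler_wpM2r => //; rewrite mulrC -ler_pdivlMr //.
    near: h; apply: filterS (nbhsx_ballx (0 : R) _ (divr_gt0 e0 f0)) => h.
    by rewrite -ball_normE /= sub0r normrN => /ltW.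
  + move=> df dE; rewrite {2 3}/flat ltxx mulr0 subr0; split.
      exact: diff_derivable.
    by rewrite deriveE // dE.
Unshelve. all: by end_near. Qed.

Lemma Ck_flat k n : Ck k setT (flat n).
Proof.
have oT : open (setT : set R) := openT.
elim: k n => [|k IH] n.
  move=> x _; apply/differentiable_continuous/derivable1_diffP.
  by have [] := is_derive_flat n x.
apply: (@Ck_derive1 _ _ _ (fun t => flat n.+2 t + cst (- n%:R) t * flat n.+1 t)) => //.
  by move=> x _; rewrite mulNr; exact: is_derive_flat.
by apply: CkD => //; apply: CkM => //; exact: Ck_cst.
Qed.

End OneVariable.

(** * Means over the unit interval *)

Section MeanValueOnUnitInterval.
Context {R : realType}.
Implicit Types phi psi : R -> R.

Definition mean01 phi : R := \int[lebesgue_measure]_(t in `[0, 1]) phi t.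

Definition cont01 phi := forall t : R, t \in `[0, 1] -> {for t, continuous phi}.

Lemma cont01_within phi : cont01 phi -> {within `[0, 1], continuous phi}.
Proof.
move=> cphi; apply: continuous_in_subspaceT => t; rewrite inE => /= t01.
exact: cphi.
Qed.

Lemma cont01_integrable phi : cont01 phi ->
  (lebesgue_measure : measure _ _).-integrable `[0 : R, 1] (EFin \o phi).
Proof.
move=> /cont01_within; apply: continuous_compact_integrable.
exact: segment_compact.
Qed.

Lemma mean01_cst (c : R) : mean01 (cst c) = c.
Proof.
rewrite /mean01 Rintegral_cst //= lebesgue_measure_itv /= lte_fin ltr01.
by rewrite oppr0 adde0 /= mulr1.
Qed.

Lemma mean01D phi psi : cont01 phi -> cont01 psi ->
  mean01 (fun t => phi t + psi t) = mean01 phi + mean01 psi.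
Proof. by move=> cp cq; apply: RintegralD => //; exact: cont01_integrable. Qed.

Lemma mean01B phi psi : cont01 phi -> cont01 psi ->
  mean01 (fun t => phi t - psi t) = mean01 phi - mean01 psi.
Proof. by move=> cp cq; apply: RintegralB => //; exact: cont01_integrable. Qed.

Lemma mean01Z c phi : cont01 phi -> mean01 (fun t => c * phi t) = c * mean01 phi.
Proof. by move=> cp; apply: RintegralZl => //; exact: cont01_integrable. Qed.

Lemma cont01_sum n (phi : 'I_n -> R -> R) :
  (forall i, cont01 (phi i)) -> cont01 (fun t => \sum_i phi i t).
Proof.
move=> cp t t01; elim: n phi cp => [|n IH] phi cp.
  rewrite (_ : (fun _ => _) = cst 0); first exact: cst_continuous.
  by apply/funext => s; rewrite big_ord0.
rewrite (_ : (fun _ => _) =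
  fun s => (\sum_(i < n) phi (widen_ord (leqnSn n) i) s) + phi ord_max s).
  by apply: continuousD; [apply: IH => i; exact: cp|exact: cp].
by apply/funext => s; rewrite big_ord_recr.
Qed.

Lemma mean01_sum n (phi : 'I_n -> R -> R) : (forall i, cont01 (phi i)) ->
  mean01 (fun t => \sum_i phi i t) = \sum_i mean01 (phi i).
Proof.
elim: n phi => [|n IH] phi cp.
  rewrite big_ord0 -[RHS](mean01_cst 0); congr mean01.
  by apply/funext => s; rewrite big_ord0.
rewrite big_ord_recr /= -IH => [|i]; last exact: cp.
rewrite -mean01D; [|by apply: cont01_sum => i; exact: cp|exact: cp].
by congr mean01; apply/funext => s; rewrite big_ord_recr.
Qed.

Lemma mean01_le phi (M : R) : cont01 phi ->
  (forall t : R, t \in `[0, 1] -> `|phi t| <= M) -> `|mean01 phi| <= M.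
Proof.
move=> cp pM; apply: le_trans (le_normr_Rintegral _ (cont01_integrable cp)) _.
  exact: measurable_itv.
rewrite -[leRHS]mean01_cst; apply: le_Rintegral => //.
- apply: (@cont01_integrable (fun t => `|phi t|)) => t t01.
  by apply: continuous_comp; [exact: cp|exact: norm_continuous].
- by apply: (@cont01_integrable (cst M)) => t t01; exact: cst_continuous.
Qed.

(** Fundamental theorem of calculus; the only fact, besides linearity and
    monotonicity, that is needed of the integral. *)
Lemma mean01_derive (Phi phi : R -> R) : cont01 phi ->
  (forall t : R, t \in `[0, 1] -> is_derive t 1 Phi (phi t)) ->
  mean01 phi = Phi 1 - Phi 0.
Proof.
move=> cp dP; have cPhi : cont01 Phi.
  move=> t /dP[dt _].
  by apply/differentiable_continuous/derivable1_diffP.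
have oc (t : R) : t \in `]0, 1[ -> t \in `[0, 1].
  by apply: subset_itv_oo_cc.
have := @continuous_FTC2 R phi Phi 0 1 ltr01 (cont01_within cp).
rewrite /mean01 /Rintegral => -> //.
- have /continuous_within_itvP := cont01_within cPhi.
  move=> /(_ ltr01)[_ c0 c1]; split=> // t /oc /dP[]//.
- by move=> t /oc /dP[_ <-]; rewrite derive1E.
Qed.

End MeanValueOnUnitInterval.

(** * Hadamard's lemma on a ball *)

Section Rays.
Context {R : realType} {n : nat} (x0 : 'rV[R]_n) (r : R).
Implicit Types (x y h : 'rV[R]_n) (t : R) (g u : 'rV[R]_n -> R).

Let B := ball x0 r.

Definition ray t x : 'rV[R]_n := x0 + t *: (x - x0).

Lemma ray_ball t x : t \in `[0, 1] -> B x -> B (ray t x).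
Proof.
rewrite in_itv /= => /andP[t0 t1]; rewrite /B -ball_normE /= => Bx.
rewrite /ray opprD addrA subrr sub0r normrN normrZ ger0_norm // distrC.
by apply: le_lt_trans Bx; rewrite -[leRHS]mul1r ler_wpM2r.
Qed.

Lemma ray_continuous : continuous (fun p : R * 'rV[R]_n => ray p.1 p.2).
Proof.
move=> p; apply: cvgD; first exact: cvg_cst.
apply: cvgZ; first exact: cvg_fst.
by apply: cvgB; [exact: cvg_snd|exact: cvg_cst].
Qed.

Lemma ray_cont01 g x : (forall z, B z -> {for z, continuous g}) -> B x ->
  cont01 (fun t => g (ray t x)).
Proof.
move=> cg Bx t t01; apply: (@continuous_comp _ _ _ (ray^~ x) g).
  apply: cvgD; first exact: cvg_cst.
  by apply: cvgZ; [exact: cvg_id|exact: cvg_cst].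
exact/cg/ray_ball.
Qed.

(** Uniform continuity along a compact segment: the values of [g] on the
    segment from [x0] to [y] approach those on the segment to [x], uniformly in
    the parameter. *)
Lemma ray_uniform g x (e : R) : (forall z, B z -> {for z, continuous g}) ->
  B x -> 0 < e ->
  \forall y \near x, forall t, t \in `[0, 1] ->
    `|g (ray t y) - g (ray t x)| <= e.
Proof.
move=> cg Bx e0.
have /compact_near_coveringP := @segment_compact R 0 1.
move=> /(_ _ (nbhs x) (fun y t => `|g (ray t y) - g (ray t x)| <= e)).
apply=> t /= t01.
have c1 : {for (t, x), continuous (fun p : R * 'rV[R]_n => g (ray p.1 p.2))}.
  apply: continuous_comp; first exact: ray_continuous.
  exact/cg/ray_ball.
have c2 : {for (t, x), continuous (fun p : R * 'rV[R]_n => g (ray p.1 x))}.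
  apply: (@continuous_comp _ _ _ (fun p : R * 'rV[R]_n => p.1) (fun t => g (ray t x))).
    exact: cvg_fst.
  exact: ray_cont01.
have : (fun p : R * 'rV[R]_n => g (ray p.1 p.2) - g (ray p.1 x)) @ (t, x) --> 0.
  rewrite -[X in _ --> X](subrr (g (ray t x))).
  exact: cvgB c1 c2.
by move=> /cvgr0_norm_le /(_ e e0).
Qed.

End Rays.

Section HadamardLemma.
Context {R : realType} {n : nat} (x0 : 'rV[R]_n) (r : R).
Implicit Types (x y h : 'rV[R]_n) (t : R) (g u : 'rV[R]_n -> R).

Let B := ball x0 r.
Notation "'d_ i" := (delta_mx 0 i : 'rV[R]_n) (at level 0, i at level 0).

Lemma le_coord_norm h (i : 'I_n) : `|h 0 i| <= `|h|.
Proof.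
rewrite [leRHS]mx_normrE.
exact: (le_bigmax _ (fun ij : 'I_1 * 'I_n => `|h ij.1 ij.2|) (0, i)).
Qed.

(** On row vectors a linear form is given by its coefficients, and it is
    automatically continuous. *)
Lemma differentiable_coef g x (c : 'I_n -> R) :
  (forall e : R, 0 < e ->
     \forall h \near (0 : 'rV[R]_n), `|g (h + x) - g x - \sum_i h 0 i * c i| <= e * `|h|) ->
  differentiable g x /\ (forall v, 'D_v g x = \sum_i v 0 i * c i).
Proof.
move=> gc; pose l v := \sum_i (v : 'rV[R]_n) 0 i * c i.
have linl : linear l.
  move=> a v w; rewrite /l scaler_sumr -big_split /=; apply: eq_bigr => i _.
  by rewrite !mxE mulrDl -mulrA.
pose lM := GRing.isLinear.Build _ _ _ _ _ linl.
pose L : {linear _ -> _} := HB.pack l lM.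
have cL : continuous L.
  move=> v; apply: (@Ck_sum _ _ 0 setT _ (fun i (w : 'rV[R]_n) => w 0 i * c i)) => //.
    exact: openT.
  move=> i w _; apply: continuousM; last exact: cst_continuous.
  exact: coord_continuous.
have [dg dE] := differentiable_eps cL gc.
by split=> // v; rewrite deriveE // dE.
Qed.

Lemma is_derive_line g (z w : 'rV[R]_n) (s : R) : differentiable g (s *: w + z) ->
  is_derive s 1 (fun s : R => g (s *: w + z)) ('D_w g (s *: w + z)).
Proof.
move=> dg.
have dl : is_diff s (fun s : R => s *: w + z) (fun s => s *: w).
  by apply: is_diff_eq; rewrite funeqE => v /=; rewrite fctE addr0.
have [dls dlE] := dl.
have dgl : differentiable (g \o (fun s : R => s *: w + z)) s.
  exact: differentiable_comp.
split; first exact: diff_derivable.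
rewrite deriveE // diff_comp //= dlE scale1r deriveE //.
Qed.

(** The factor [t ^+ m] makes this family of operators closed under
    derivation: differentiating under the integral sign turns [ray_mean m g]
    into [ray_mean m.+1] of a derivative of [g]. *)
Definition ray_mean m g x : R := mean01 (fun t => t ^+ m * g (ray x0 t x)).

Lemma eq_mean01 (phi psi : R -> R) :
  (forall t : R, t \in `[0, 1] -> phi t = psi t) -> mean01 phi = mean01 psi.
Proof. by move=> pp; apply: eq_Rintegral => t; rewrite inE => /pp. Qed.

Lemma exp_ray_cont01 m g x : (forall z, B z -> {for z, continuous g}) -> B x ->
  cont01 (fun t => t ^+ m * g (ray x0 t x)).
Proof.
move=> cg Bx t t01; apply: continuousM; last exact: ray_cont01 cg Bx _ t01.
exact: exprn_continuous.
Qed.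

Lemma exp01_le1 t m : t \in `[0, 1] -> 0 <= t ^+ m <= 1.
Proof.
by rewrite in_itv => /andP[t0 t1]; rewrite exprn_ge0 //= exprn_ile1.
Qed.

Lemma ray_mean_continuous m g x : (forall z, B z -> {for z, continuous g}) ->
  B x -> {for x, continuous (ray_mean m g)}.
Proof.
move=> cg Bx; rewrite /prop_for /continuous_at; apply/(@cvgrPdist_le _ _ _ (nbhs x)) => e e0.
have By : \forall y \near x, B y by apply: (open_near (ball_open _ _) Bx).
move: By (ray_uniform cg Bx e0); apply: filterS2 => y By gy.
rewrite distrC /ray_mean -mean01B; [|exact: exp_ray_cont01..].
apply: mean01_le => [|t t01].
  by move=> t t01; apply: continuousB; exact: (@exp_ray_cont01 _ _ _ cg).
rewrite -mulrBr normrM; have /andP[t0 t1] := exp01_le1 m t01.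
by rewrite ger0_norm // -[leRHS]mul1r ler_pM // gy.
Qed.

(** Differentiation under the integral sign. By the mean value theorem the
    increment of [g] along the segment from [ray t x] to [ray t (h + x)] is the
    differential at an intermediate point, which is uniformly close to the
    differential at [ray t x]. *)
Lemma ray_mean_diff m g x : (forall z, B z -> differentiable g z) ->
  (forall i z, B z -> {for z, continuous ('D_('d_ i) g)}) -> B x ->
  differentiable (ray_mean m g) x /\
  (forall v, 'D_v (ray_mean m g) x = ray_mean m.+1 ('D_v g) x).
Proof.
move=> dg cdg Bx.
have cg z : B z -> {for z, continuous g}.
  by move=> /dg; exact: differentiable_continuous.
have cI i : cont01 (fun t => t ^+ m.+1 * 'D_('d_ i) g (ray x0 t x)).
  exact: exp_ray_cont01 (cdg i) Bx.
have cIv (v : 'rV[R]_n) i :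
    cont01 (fun t => v 0 i * (t ^+ m.+1 * 'D_('d_ i) g (ray x0 t x))).
  by move=> t t01; apply: continuousM; [exact: cst_continuous|exact: cI].
have sumE (v : 'rV[R]_n) : mean01 (fun t => \sum_i v 0 i * (t ^+ m.+1 * 'D_('d_ i) g (ray x0 t x)))
    = \sum_i v 0 i * ray_mean m.+1 ('D_('d_ i) g) x.
  by rewrite mean01_sum //; apply: eq_bigr => i _; rewrite mean01Z.
suff [? E] : differentiable (ray_mean m g) x /\ (forall v, 'D_v (ray_mean m g) x =
    \sum_i v 0 i * ray_mean m.+1 ('D_('d_ i) g) x).
  split=> // v; rewrite E -sumE; apply: eq_mean01 => t t01.
  rewrite derive_rV; last by apply/dg/ray_ball.
  by rewrite mulr_sumr; apply: eq_bigr => i _; rewrite mulrC -mulrA.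
apply: differentiable_coef => e e0.
(* The n coordinates share the error; n + 1 rather than n avoids dividing by 0. *)
have e'0 : 0 < e / n.+1%:R by rewrite divr_gt0.
pose close i y := forall t, t \in `[0, 1] ->
  `|'D_('d_ i) g (ray x0 t y) - 'D_('d_ i) g (ray x0 t x)| <= e / n.+1%:R.
have near_all : \forall y \near x, B y /\ forall i, close i y.
  have By : \forall y \near x, B y by apply: (open_near (ball_open _ _) Bx).
  have closex : \forall y \near x, forall i, close i y.
    apply: (@filter_forall _ _ close (nbhs x)) => i.
    exact: ray_uniform (cdg i) Bx e'0.
  exact: filterI By closex.
have /nbhs_ballP[d /= d0 xd] := near_all.
near=> h; have hd : `|h| < d.
  near: h; apply: filterS (nbhsx_ballx (0 : 'rV[R]_n) _ d0) => h.
  by rewrite -ball_normE /= sub0r normrN.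
have xsh (s : R) : s \in `[0, 1] -> ball x d (s *: h + x).
  rewrite in_itv /= => /andP[s0 s1]; rewrite -ball_normE /= opprD addrCA subrr addr0.
  rewrite normrN normrZ ger0_norm //; apply: le_lt_trans hd.
  by rewrite -[leRHS]mul1r ler_wpM2r.
have Bxh : B (h + x).
  by have := xsh 1; rewrite scale1r => /(_ _)/xd[]//; rewrite in_itv /= ler01 lexx.
rewrite -sumE /ray_mean -mean01B; [|exact: exp_ray_cont01..].
have cB : cont01 (fun t => t ^+ m * g (ray x0 t (h + x)) - t ^+ m * g (ray x0 t x)).
  by move=> t t01; apply: continuousB; exact: (@exp_ray_cont01 _ _ _ cg).
rewrite -mean01B //; last exact: cont01_sum.
apply: mean01_le => [|t t01].
  by move=> t t01; apply: continuousB; [exact: cB|exact: cont01_sum].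
have [t0 t1] : 0 <= t /\ t <= 1 by move: t01; rewrite in_itv => /andP.
have lineE (s : R) : ray x0 t (s *: h + x) = s *: (t *: h) + ray x0 t x.
  by rewrite /ray -addrA scalerDr [RHS]addrCA !scalerA [t * s]mulrC.
have dline (s : R) : s \in `[0, 1] ->
    is_derive s 1 (fun s => g (s *: (t *: h) + ray x0 t x))
      (t * \sum_i h 0 i * 'D_('d_ i) g (ray x0 t (s *: h + x))).
  move=> s01; have dgs : differentiable g (s *: (t *: h) + ray x0 t x).
    by rewrite -lineE; apply/dg/ray_ball => //; have /xd[] := xsh s s01.
  apply: is_derive_eq (is_derive_line dgs) _.
  rewrite derive_rV // lineE mulr_sumr; apply: eq_bigr => i _.
  by rewrite mxE mulrC mulrA.
pose phi s := g (s *: (t *: h) + ray x0 t x).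
pose dphi s := t * \sum_i h 0 i * 'D_('d_ i) g (ray x0 t (s *: h + x)).
have dphiP (s : R) : s \in `]0, 1[ -> is_derive s 1 phi (dphi s).
  by move=> s01; apply: dline; exact: subset_itv_oo_cc s01.
have cphi : {within `[0, 1], continuous phi}.
  apply: cont01_within => s /dline[ds _].
  exact/differentiable_continuous/derivable1_diffP.
have [c c01] := MVT_segment ler01 dphiP cphi.
rewrite /phi /dphi => gE.
move: gE; rewrite -!lineE scale1r scale0r add0r subr0 mulr1 => gE.
rewrite -mulrBr gE mulrA -exprSr mulr_sumr -sumrB.
apply: le_trans (ler_norm_sum _ _ _) _.
have /xd[_ Dc] := xsh c c01.
apply: (@le_trans _ _ (\sum_(i < n) e / n.+1%:R * `|h|)).
  apply: ler_sum => i _; rewrite mulrCA -mulrBr -mulrBr.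
  rewrite normrM [leRHS]mulrC; apply: ler_pM => //; first exact: le_coord_norm.
  rewrite normrM -[leRHS]mul1r; apply: ler_pM => //; last exact: Dc.
  by have /andP[tm0 tm1] := exp01_le1 m.+1 t01; rewrite ger0_norm.
rewrite sumr_const card_ord -[leLHS]mulr_natr mulrAC; apply: ler_wpM2r => //.
rewrite -mulrA; apply: ler_piMr; first exact: ltW.
by rewrite mulrC ler_pdivrMr // mul1r ler_nat.
Unshelve. all: by end_near. Qed.

Lemma Ck_ray_mean k m g : Ck k.+1 B g -> Ck k B (ray_mean m g).
Proof.
elim: k m g => [|k IH] m g Cg.
  by move=> x Bx; apply: ray_mean_continuous => // z Bz; exact: (CkS Cg).
have Cg1 : Ck 1%N B g.
  elim: {IH} k Cg => [|k IHk] Cg; first exact: CkS Cg.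
  by apply: IHk; exact: (CkS Cg).
have D z : B z -> differentiable (ray_mean m g) z /\
    (forall v, 'D_v (ray_mean m g) z = ray_mean m.+1 ('D_v g) z).
  move=> Bz; apply: ray_mean_diff => //; first by have [] := Cg1.
  by move=> i w Bw; have [_ cD] := Cg1; exact: (cD _ w Bw).
split=> [z /D[]//|v].
apply: (@Ck_ext _ _ _ _ _ (ray_mean m.+1 ('D_v g))).
- exact: ball_open.
- by move=> z /D[_ ->].
- by apply: IH; have [_ cD] := Cg; exact: cD.
Qed.

(** Hadamard's lemma: write the increment from [x0] to [x] as the integral of
    the derivative along the ray; the factors are the means of the partial
    derivatives over the ray. *)
Lemma hadamard u : 0 < r -> smooth_on B u ->
  exists w : 'I_n -> 'rV[R]_n -> R, (forall i, smooth_on B (w i)) /\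
    forall x, B x -> u x - u x0 = \sum_i (x 0 i - x0 0 i) * w i x.
Proof.
move=> r0 su; exists (fun i => ray_mean 0 ('D_('d_ i) u)); split.
  by move=> i k; apply: Ck_ray_mean; have [_ cD] := su k.+2; exact: cD.
move=> x Bx.
have [du cdu] := su 1%N.
have cI i : cont01 (fun t => 'D_('d_ i) u (ray x0 t x)).
  exact: ray_cont01 (cdu _) Bx.
have cIv i : cont01 (fun t => (x 0 i - x0 0 i) * 'D_('d_ i) u (ray x0 t x)).
  by move=> t t01; apply: continuousM; [exact: cst_continuous|exact: cI].
have -> : u x - u x0 = u (1 *: (x - x0) + x0) - u (0 *: (x - x0) + x0).
  by rewrite scale1r subrK scale0r add0r.
pose phi t := \sum_i (x 0 i - x0 0 i) * 'D_('d_ i) u (ray x0 t x).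
have dphi t : t \in `[0, 1] ->
    is_derive t 1 (fun t => u (t *: (x - x0) + x0)) (phi t).
  move=> t01; have dut : differentiable u (t *: (x - x0) + x0).
    by rewrite addrC; apply: du; exact: ray_ball.
  apply: is_derive_eq (is_derive_line dut) _.
  rewrite derive_rV //; apply: eq_bigr => i _.
  by rewrite mulrC !mxE /ray [x0 + _]addrC.
rewrite -(mean01_derive (cont01_sum cIv) dphi) mean01_sum //.
apply: eq_bigr => i _; rewrite mean01Z //.
by congr (_ * _); apply: eq_mean01 => t _; rewrite mul1r.
Qed.

End HadamardLemma.

(** * Smooth functions on a manifold *)

Section SmoothFunctions.
Context {R : realType} {n : nat} {M : manifold R n}.
Implicit Types (f h : M -> R) (c : chart R n M) (p q : M).

Lemma open_chart_dom c : atlas c -> open (chart_dom c).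
Proof. by move=> /atlas_chart[]. Qed.

Lemma open_chart_cod c : atlas c -> open (chart_cod c).
Proof. by move=> /atlas_chart[]. Qed.

Lemma chart_mapK c p : atlas c -> chart_dom c p -> chart_inv c (chart_map c p) = p.
Proof. by move=> /atlas_chart[_ _ cK _ _] /cK. Qed.

Lemma chart_codP c y : atlas c -> chart_cod c y ->
  chart_dom c (chart_inv c y) /\ chart_map c (chart_inv c y) = y.
Proof. by move=> ac [q qc <-]; rewrite chart_mapK. Qed.

Lemma smooth_fun_cst (a : R) : smooth_fun (fun _ : M => a).
Proof. by move=> c ac k; exact: (Ck_cst k _ a). Qed.

Lemma smooth_funD f h : smooth_fun f -> smooth_fun h ->
  smooth_fun (fun q => f q + h q).
Proof.
move=> sf sh c ac k.
by apply: CkD; [exact: open_chart_cod|exact: sf|exact: sh].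
Qed.

Lemma smooth_funM f h : smooth_fun f -> smooth_fun h ->
  smooth_fun (fun q => f q * h q).
Proof.
move=> sf sh c ac k.
by apply: CkM; [exact: open_chart_cod|exact: sf|exact: sh].
Qed.

Lemma smooth_funZ (a : R) f : smooth_fun f -> smooth_fun (fun q => a * f q).
Proof. by move=> sf; apply: smooth_funM => //; exact: smooth_fun_cst. Qed.

Lemma smooth_funN f : smooth_fun f -> smooth_fun (fun q => - f q).
Proof.
move=> sf; rewrite (_ : (fun _ => _) = fun q => -1 * f q).
  exact: smooth_funZ.
by apply/funext => q; rewrite mulN1r.
Qed.

Lemma smooth_funB f h : smooth_fun f -> smooth_fun h ->
  smooth_fun (fun q => f q - h q).
Proof. by move=> sf sh; apply: smooth_funD => //; exact: smooth_funN. Qed.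

Lemma smooth_fun_sum m (f : 'I_m -> M -> R) : (forall i, smooth_fun (f i)) ->
  smooth_fun (fun q => \sum_i f i q).
Proof.
move=> sf c ac k; apply: (@Ck_sum _ _ _ _ _ (fun i => f i \o chart_inv c)).
  exact: open_chart_cod.
by move=> i; exact: sf.
Qed.

Lemma smooth_fun_powR (a : R) f : smooth_fun f -> (forall q, 0 < f q) ->
  smooth_fun (fun q => f q `^ a).
Proof.
move=> sf f0 c ac k.
apply: (@Ck_comp1 _ _ _ _ [set t : R | 0 < t] (f \o chart_inv c)
  (fun t => t `^ a)).
- exact: open_chart_cod.
- by move=> x _; exact: f0.
- exact: sf.
- exact: Ck_powR.
Qed.

Lemma open_preimageI (T U : topologicalType) (A : set T) (C : set U) (F : T -> U) :
  open A -> open C -> (forall x, A x -> {for x, continuous F}) ->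
  open (A `&` F @^-1` C).
Proof.
move=> oA oC cF; rewrite openE => x [Ax CFx].
apply: filterI; first exact: open_nbhs_nbhs.
by apply: (cF x Ax); exact: open_nbhs_nbhs.
Qed.

(** A function of the coordinates, transported to the coordinate ball and
    extended by 0 to the manifold. *)
Definition chart_extend c (x0 : 'rV[R]_n) (r : R) (w : 'rV[R]_n -> R) : M -> R :=
  fun q => if `[< chart_dom c q /\ ball x0 r (chart_map c q) >]
           then w (chart_map c q) else 0.

(** A function supported in a smaller closed ball extends by 0 to a smooth
    function. The support is compact, hence closed in the Hausdorff space [M];
    every point is thus either in the coordinate ball, where changes of charts
    are smooth, or in the open complement of the support, where the extension
    vanishes. *)
Lemma smooth_chart_extend c x0 (r s : R) w : atlas c -> 0 < s -> s < r ->
  ball x0 r `<=` chart_cod c -> smooth_on (ball x0 r) w ->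
  (forall y, s <= `|x0 - y| -> w y = 0) ->
  smooth_fun (chart_extend c x0 r w).
Proof.
move=> ac s0 sr cod_r sw w0 c' ac' k.
pose G := chart_dom c `&` chart_map c @^-1` (ball x0 r).
pose K := [set y : 'rV[R]_n | `|x0 - y| <= s].
have Kball y : K y -> ball x0 r y.
  by rewrite /K -ball_normE /= => ys; exact: le_lt_trans sr.
have [_ _ _ cmap cinv] := atlas_chart ac.
have oG : open G.
  by apply: open_preimageI => //; [exact: open_chart_dom|exact: ball_open].
have cptK : compact K.
  apply: bounded_closed_compact.
    exists (`|x0| + s); split; first exact: num_real.
    move=> t xt y Ky; rewrite -(subKr x0 y); apply: le_trans (ltW xt).
    by apply: le_trans (ler_normB _ _) _; rewrite lerD2l.
  have -> : K = closed_ball x0 s by rewrite closed_ballE.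
  exact: closed_ball_closed.
have clS : closed (chart_inv c @` K).
  apply: compact_closed; first exact: mf_hausdorff.
  apply: continuous_compact => //; apply: continuous_in_subspaceT => y.
  by rewrite inE => /Kball/cod_r/cinv.
have SG q : (chart_inv c @` K) q -> G q.
  by move=> [y /Kball yr <-]; have [? E] := chart_codP ac (cod_r _ yr); split; rewrite //= E.
have notS q : ~ (chart_inv c @` K) q -> chart_extend c x0 r w q = 0.
  move=> nS; rewrite /chart_extend; case: asboolP => // -[qc qr].
  apply: w0; rewrite leNgt; apply/negP => /ltW qs; apply: nS.
  by exists (chart_map c q) => //; rewrite chart_mapK.
have [_ _ _ _ cinv'] := atlas_chart ac'.
apply: Ck_local => y y'; have [Sy|nSy] := pselect ((chart_inv c @` K) (chart_inv c' y)).
- pose O := chart_cod c' `&` chart_inv c' @^-1` G.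
  have oO : open O by apply: open_preimageI => //; exact: open_chart_cod.
  exists O; first by split=> //; exact: SG.
  apply: (@Ck_ext _ _ _ _ _ (w \o (chart_map c \o chart_inv c'))) => //.
    by move=> z [_ [zc zr]]; rewrite /= /chart_extend asboolT.
  apply: (@Ck_comp _ _ _ _ _ (ball x0 r)) => //.
  + by move=> z [_ []].
  + apply: Ck_sub (atlas_compatible ac' ac k) => z [zc' [zc _]].
    have [? E] := chart_codP ac' zc'.
    by exists (chart_inv c' z).
- pose O := chart_cod c' `&` chart_inv c' @^-1` (~` (chart_inv c @` K)).
  have oO : open O.
    by apply: open_preimageI => //; [exact: open_chart_cod|exact: closed_openC].
  exists O => //.
  apply: (@Ck_ext _ _ _ _ _ (cst 0)) => //; last exact: Ck_cst.
  by move=> z [_ nSz]; rewrite /= notS.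
Qed.

End SmoothFunctions.

Section Bump.
Context {R : realType} {n : nat}.
Implicit Types (x y : 'rV[R]_n).

Lemma norm_le_sum_sqr y : `|y| ^+ 2 <= \sum_i y 0 i ^+ 2.
Proof.
have [y0|yn0] := eqVneq (`|y|) 0.
  by rewrite y0 expr0n sumr_ge0 // => i _; exact: sqr_ge0.
have [[i j] /= yE] := mx_norm_neq0 yn0.
have {}yE : `|y| = `|y 0 j| by rewrite -(ord1 i) -yE.
by rewrite yE real_normK ?num_real // (bigD1 j) //= lerDl sumr_ge0 // => k _; exact: sqr_ge0.
Qed.

(** Normalised to take the value 1 at the center; the argument of [flat] is
    negative outside the Euclidean ball of radius [s]. *)
Definition bump x0 (s : R) y : R :=
  flat 0 (s ^+ 2 - \sum_i (y 0 i - x0 0 i) ^+ 2) / flat 0 (s ^+ 2).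

Lemma bump_center x0 s : 0 < s -> bump x0 s x0 = 1.
Proof.
move=> s0; rewrite /bump big1 ?subr0 => [|i _]; last by rewrite subrr expr0n.
by rewrite divff // /flat exprn_gt0 // expr0 mul1r expR_eq0.
Qed.

Lemma bump_out x0 s y : 0 < s -> s <= `|x0 - y| -> bump x0 s y = 0.
Proof.
move=> s0 sy; rewrite /bump {1}/flat ifF ?mul0r //; apply/negbTE.
rewrite -leNgt subr_le0; apply: le_trans (_ : _ <= `|y - x0| ^+ 2) _.
  by rewrite distrC ler_pXn2r ?nnegrE // ltW.
by apply: le_trans (norm_le_sum_sqr _) _; apply: ler_sum => i _; rewrite !mxE.
Qed.

Lemma smooth_coord (O : set 'rV[R]_n) (i : 'I_n) (a : R) :
  open O -> smooth_on O (fun y : 'rV[R]_n => y 0 i - a).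
Proof.
move=> oO k; apply: CkD => //; last exact: Ck_cst.
apply: (@Ck_coord _ _ _ _ _ id) => //.
elim: k => [|k IH]; first by move=> x _; exact: cvg_id.
split=> [x _|v]; first exact: ex_diff.
rewrite (_ : 'D_v _ = cst v); first exact: Ck_cst.
by apply/funext => x; rewrite derive_id.
Qed.

Lemma smooth_bump (O : set 'rV[R]_n) x0 s : open O -> smooth_on O (bump x0 s).
Proof.
move=> oO k; apply: CkM => //; last exact: Ck_cst.
apply: (@Ck_comp1 _ _ _ _ setT) => //; last exact: Ck_flat.
apply: (@Ck_ext _ _ _ _ _ (fun y : 'rV[R]_n => s ^+ 2 +
   -1 * \sum_i (y 0 i - x0 0 i) * (y 0 i - x0 0 i))) => //.
  by move=> y _; rewrite mulN1r; under eq_bigr do rewrite -expr2.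
apply: CkD => //; first exact: Ck_cst.
apply: CkM => //; first exact: Ck_cst.
by apply: Ck_sum => // i; apply: CkM => //; exact: smooth_coord.
Qed.

End Bump.

(** * The dimension of the tangent spaces *)

Section TangentSpace.
Context {R : realType} {n : nat} {M : manifold R n}.
Implicit Types (f h : M -> R) (p q : M) (v : functional M).

Lemma tangentD p v f h : tangent p v -> smooth_fun f -> smooth_fun h ->
  v (fun q => f q + h q) = v f + v h.
Proof.
move=> [lv _ _] sf sh; rewrite -[v f]mul1r -lv //; congr v.
by apply/funext => q; rewrite mul1r.
Qed.

Lemma tangent_fun0 p v : tangent p v -> v (fun _ => 0) = 0.
Proof.
move=> tv; have s0 := @smooth_fun_cst R n M 0.
have := tangentD tv s0 s0; under eq_fun do rewrite addr0.
by move=> /eqP; rewrite -subr_eq0 opprD addrA subrr sub0r oppr_eq0 => /eqP.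
Qed.

Lemma tangentZ p v (a : R) f : tangent p v -> smooth_fun f ->
  v (fun q => a * f q) = a * v f.
Proof.
move=> tv sf; have [lv _ _] := tv.
have := lv a f (fun _ => 0) sf (@smooth_fun_cst _ _ _ 0).
by rewrite (tangent_fun0 tv) addr0; under eq_fun do rewrite addr0.
Qed.

Lemma tangentM p v f h : tangent p v -> smooth_fun f -> smooth_fun h ->
  v (fun q => f q * h q) = f p * v h + h p * v f.
Proof. by move=> [_ lv _]; exact: lv. Qed.

Lemma tangent_cst p v (a : R) : tangent p v -> v (fun _ => a) = 0.
Proof.
move=> tv; have s1 := @smooth_fun_cst R n M 1.
have v1 : v (fun _ => 1) = 0.
  have := tangentM tv s1 s1; under eq_fun do rewrite mul1r.
  by rewrite !mul1r => /eqP; rewrite -subr_eq0 opprD addrA subrr sub0r oppr_eq0 => /eqP.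
have := tangentZ a tv s1; rewrite v1 mulr0 => <-; congr v.
by apply/funext => q; rewrite mulr1.
Qed.

Lemma tangent_sum p v m (f : 'I_m -> M -> R) : tangent p v ->
  (forall i, smooth_fun (f i)) -> v (fun q => \sum_i f i q) = \sum_i v (f i).
Proof.
move=> tv; elim: m f => [|m IH] f sf.
  by rewrite big_ord0; under eq_fun do rewrite big_ord0; exact: (tangent_fun0 tv).
under eq_fun do rewrite big_ord_recr /=.
rewrite big_ord_recr /= -IH => [|i]; last exact: sf.
apply: (tangentD tv); [exact: smooth_fun_sum|exact: sf].
Qed.

(** The tangent space has at most [n] dimensions. By the lemma of Hadamard,
    multiplied by the square of a bump function [b], every smooth [f] satisfies
    [b * b * f = f p * (b * b) + \sum_i z i * h i] on the whole manifold, where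
    the [z i] are the coordinates cut off by [b], which vanish at [p]. The
    Leibniz rule then gives [v f = \sum_i h i p * v (z i)]. *)
Lemma tangent_coordinates p : exists z : 'I_n -> M -> R, forall f, smooth_fun f ->
  exists k : 'I_n -> R, forall v, tangent p v -> v f = \sum_i k i * v (z i).
Proof.
have [c ac cp] := atlas_cover p.
pose x0 := chart_map c p.
have cod0 : chart_cod c x0 by exists p.
have /nbhs_ballP[r /= r0 rcod] := open_nbhs_nbhs (conj (open_chart_cod ac) cod0).
pose s := r / 2; have s0 : 0 < s by rewrite divr_gt0.
have sr : s < r by rewrite /s ltr_pdivrMr // ltr_pMr // ltr1n.
have oB : open (ball x0 r) by exact: ball_open.
pose E w := chart_extend c x0 r (fun y => bump x0 s y * w y).
have sE w : smooth_on (ball x0 r) w -> smooth_fun (E w).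
  move=> sw; apply: (@smooth_chart_extend _ _ _ _ _ _ s) => //.
    by move=> k; apply: CkM => //; exact: smooth_bump.
  by move=> y sy; rewrite bump_out // mul0r.
have Ep w : E w p = w x0.
  rewrite /E /chart_extend asboolT ?bump_center ?mul1r //.
  by split=> //; exact: ballxx.
pose z i := E (fun y => y 0 i - x0 0 i).
exists z => f sf.
have su : smooth_on (ball x0 r) (f \o chart_inv c).
  by move=> k; apply: Ck_sub rcod _; exact: sf.
have [w [sw fw]] := hadamard r0 su.
exists (fun i => w i x0) => v tv.
have sz i : smooth_fun (z i) by apply: sE; exact: smooth_coord.
have sw' i : smooth_fun (E (w i)) by exact: sE.
pose b := E (fun _ => 1).
have sb : smooth_fun b by apply: sE => k; exact: Ck_cst.
have sbb : smooth_fun (fun q => b q * b q) by exact: smooth_funM.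
(* Two factors b: each of the two factors of every product has to be cut off. *)
have fE : (fun q => b q * b q * f q) =
    (fun q => f p * (b q * b q) + \sum_i z i q * E (w i) q).
  apply/funext => q; rewrite /z /b /E /chart_extend; case: asboolP => [[qc qr]|_].
    have := fw _ qr; rewrite /= !chart_mapK // => /eqP; rewrite subr_eq => /eqP ->.
    rewrite mulrDr addrC; congr (_ + _); first by ring.
    by rewrite mulr_sumr; apply: eq_bigr => i _; ring.
  by rewrite !mul0r !mulr0 add0r big1 // => i _; rewrite mul0r.
have := congr1 v fE.
rewrite (tangentM tv) // (tangentD tv); last 2 first.
- exact: smooth_funZ.
- by apply: smooth_fun_sum => i; exact: smooth_funM.
rewrite (tangentZ _ tv) // (tangent_sum tv) => [|i]; last exact: smooth_funM.
rewrite /b Ep !mul1r addrC => /addrI ->; apply: eq_bigr => i _.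
by rewrite (tangentM tv) // /z !Ep subrr mul0r add0r.
Qed.

(** A tangent vector is determined by its [n] values on the cut-off
    coordinates, so [n + 1] of them are linearly dependent. *)
Lemma tangent_dependent p (s : 'I_n.+1 -> functional M) :
  (forall i, tangent p (s i)) ->
  exists k : 'I_n.+1 -> R, (exists i, k i != 0) /\ \sum_i k i *: s i = 0.
Proof.
move=> ts; have [z zP] := tangent_coordinates p.
pose A := \matrix_(i < n.+1, j < n) s i (z j).
have : kermx A != 0.
  rewrite kermx_eq0 /row_free neq_ltn; apply/orP; left.
  by rewrite ltnS rank_leq_col.
move=> /rowV0Pn[k /sub_kermxP kA k0].
exists (k 0); split.
  apply/existsP; apply: contraNT k0 => /existsPn k0.
  by apply/eqP/rowP => i; rewrite mxE; apply/eqP; have := k0 i; rewrite negbK.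
have kz j : \sum_i k 0 i * s i (z j) = 0.
  have := congr1 (fun v : 'rV[R]_n => v 0 j) kA; rewrite !mxE => kAj.
  by rewrite -[RHS]kAj; apply: eq_bigr => i _; rewrite mxE.
apply/funext => f; rewrite [LHS](_ : _ = \sum_i k 0 i * s i f); last first.
  by elim/big_rec2: _ => // i y1 y2 _ <-.
have [sf|nsf] := pselect (smooth_fun f); last first.
  by rewrite big1 // => i _; have [_ _ ->] := ts i; rewrite ?mulr0.
have [m mP] := zP f sf.
rewrite (eq_bigr (fun i => \sum_j m j * (k 0 i * s i (z j)))) => [|i _].
  by rewrite exchange_big big1 //= => j _; rewrite -mulr_sumr kz mulr0.
by rewrite (mP _ (ts i)) mulr_sumr; apply: eq_bigr => j _; rewrite mulrCA.
Qed.

End TangentSpace.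

(** * Vector fields and Riemannian metrics *)

Section VectorFields.
Context {R : realType} {n : nat} {M : manifold R n}.
Implicit Types (X Y : vfield M) (f : M -> R) (p q : M) (u v : functional M).

Lemma tangent_lin p (a : R) u v : tangent p u -> tangent p v ->
  tangent p (a *: u + v).
Proof.
move=> [lu mu nu] [lv mv nv]; split=> [k f h sf sh|f h sf sh|f nf].
- rewrite -[LHS]/(a * u _ + v _) lu // lv //.
  by rewrite -[(_ + _ : functional M) f]/(a * u f + v f) -[(_ + _ : functional M) h]/(a * u h + v h); ring.
- rewrite -[LHS]/(a * u _ + v _) mu // mv //.
  by rewrite -[(_ + _ : functional M) f]/(a * u f + v f) -[(_ + _ : functional M) h]/(a * u h + v h); ring.
- by rewrite -[LHS]/(a * u f + v f) nu // nv // mulr0 addr0.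
Qed.

Lemma tangent0 p : tangent p (0 : functional M).
Proof. by split=> *; rewrite -[LHS]/(0 : R) -?[_ f]/(0 : R) -?[_ h]/(0 : R) ?mulr0 ?addr0. Qed.

Lemma tangent_scale p (a : R) u : tangent p u -> tangent p (a *: u).
Proof. by move=> tu; rewrite -[_ *: _]addr0; apply: tangent_lin => //; exact: tangent0. Qed.

Lemma tangent_add p u v : tangent p u -> tangent p v -> tangent p (u + v).
Proof. by move=> tu tv; rewrite -[u]scale1r; exact: tangent_lin. Qed.

Lemma tangent_sub p u v : tangent p u -> tangent p v -> tangent p (u - v).
Proof. by move=> tu tv; rewrite -scaleN1r; apply: tangent_add => //; exact: tangent_scale. Qed.

Lemma smooth_vfield_fscale f X : smooth_fun f -> smooth_vfield X ->
  smooth_vfield (fscale f X).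
Proof.
move=> sf [tX sX]; split=> [p|h sh]; first exact: tangent_scale.
by apply: smooth_funM => //; exact: sX.
Qed.

Lemma smooth_vfieldD X Y : smooth_vfield X -> smooth_vfield Y ->
  smooth_vfield (X + Y).
Proof.
move=> [tX sX] [tY sY]; split=> [p|h sh]; first exact: tangent_add.
by apply: smooth_funD; [exact: sX|exact: sY].
Qed.

Lemma smooth_vfieldZ (a : R) X : smooth_vfield X -> smooth_vfield (a *: X).
Proof. by move=> sX; apply: (smooth_vfield_fscale (@smooth_fun_cst _ _ _ a)). Qed.

Lemma smooth_vfieldB X Y : smooth_vfield X -> smooth_vfield Y ->
  smooth_vfield (X - Y).
Proof.
by move=> sX sY; rewrite -scaleN1r; apply: smooth_vfieldD => //; exact: smooth_vfieldZ.
Qed.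

End VectorFields.

Section RiemannianMetric.
Context {R : realType} {n : nat} {M : manifold R n}.
Context (g : metric M) (g_riem : riemannian g).
Implicit Types (p : M) (u v w : functional M).

Lemma metricC p u v : tangent p u -> tangent p v -> g p u v = g p v u.
Proof. by have [_ + _ _] := g_riem; exact. Qed.

Lemma metric_linl p (a : R) u v w : tangent p u -> tangent p v -> tangent p w ->
  g p (a *: u + v) w = a * g p u w + g p v w.
Proof. by have [+ _ _ _] := g_riem; exact. Qed.

Lemma metricDl p u v w : tangent p u -> tangent p v -> tangent p w ->
  g p (u + v) w = g p u w + g p v w.
Proof. by move=> tu tv tw; rewrite -[u in LHS]scale1r metric_linl // mul1r. Qed.

Lemma metric0l p w : tangent p w -> g p 0 w = 0.
Proof.
move=> tw; have t0 := @tangent0 R n M p.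
have := metricDl t0 t0 tw; rewrite addr0 => /eqP.
by rewrite -subr_eq0 opprD addrA subrr sub0r oppr_eq0 => /eqP.
Qed.

Lemma metricZl p (a : R) u w : tangent p u -> tangent p w ->
  g p (a *: u) w = a * g p u w.
Proof.
move=> tu tw; have t0 := @tangent0 R n M p.
by rewrite -[a *: u]addr0 metric_linl // metric0l // addr0.
Qed.

Lemma metricBl p u v w : tangent p u -> tangent p v -> tangent p w ->
  g p (u - v) w = g p u w - g p v w.
Proof.
move=> tu tv tw; rewrite -scaleN1r metricDl //; last exact: tangent_scale.
by rewrite metricZl // mulN1r.
Qed.

Lemma metricDr p u v w : tangent p u -> tangent p v -> tangent p w ->
  g p w (u + v) = g p w u + g p w v.
Proof.
move=> tu tv tw; rewrite metricC //; last exact: tangent_add.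
by rewrite metricDl // ![g p _ w]metricC.
Qed.

Lemma metricZr p (a : R) u w : tangent p u -> tangent p w ->
  g p w (a *: u) = a * g p w u.
Proof.
move=> tu tw; rewrite metricC //; last exact: tangent_scale.
by rewrite metricZl // [g p _ w]metricC.
Qed.

Lemma metricBr p u v w : tangent p u -> tangent p v -> tangent p w ->
  g p w (u - v) = g p w u - g p w v.
Proof.
move=> tu tv tw; rewrite metricC //; last exact: tangent_sub.
by rewrite metricBl // ![g p _ w]metricC.
Qed.

Lemma metric_gt0 p u : tangent p u -> u <> 0 -> 0 < g p u u.
Proof. by have [_ _ + _] := g_riem; exact. Qed.

Lemma metric_ge0 p u : tangent p u -> 0 <= g p u u.
Proof.
move=> tu; have [->|/(metric_gt0 tu)/ltW//] := pselect (u = 0).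
by rewrite metric0l //; exact: tangent0.
Qed.

Lemma metric_eq0 p u : tangent p u -> g p u u = 0 -> u = 0.
Proof.
move=> tu guu; have [//|/(metric_gt0 tu)] := pselect (u = 0).
by rewrite guu ltxx.
Qed.

Lemma metric_line p y u (s : R) : tangent p y -> tangent p u ->
  g p (y + s *: u) (y + s *: u) =
  g p y y + s * (2 * g p y u) + s ^+ 2 * g p u u.
Proof.
move=> ty tu; have tsu := tangent_scale s tu; have tysu := tangent_add ty tsu.
rewrite metricDl // !metricDr // !metricZl // !metricZr // [g p u y]metricC //.
by ring.
Qed.

(** The usual minimum of the nonnegative quadratic polynomial in the
    coefficient of [y]. *)
Lemma metric_cauchy_schwarz p y u : tangent p y -> tangent p u -> y <> 0 ->
  g p y u ^+ 2 <= g p y y * g p u u.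
Proof.
move=> ty tu /(metric_gt0 ty) y0.
pose s := - (g p y u / g p y y).
have := metric_ge0 (tangent_add tu (tangent_scale s ty)).
rewrite metric_line // [g p u y]metricC //.
have -> : g p u u + s * (2 * g p y u) + s ^+ 2 * g p y y =
  (g p y y * g p u u - g p y u ^+ 2) / g p y y.
  by rewrite /s; field; rewrite gt_eqF.
by rewrite pmulr_lge0 ?invr_gt0 // subr_ge0.
Qed.

End RiemannianMetric.

(** * The fundamental and Cartan tensors of a Randers metric *)

Section RandersTensors.
Context {R : realType} {n : nat} {M : manifold R n}.
Context (g : metric M) (g_riem : riemannian g) (Q : vfield M).
Implicit Types (p : M) (y u v w : functional M).

Definition len p y : R := Num.sqrt (g p y y).

(** The derivative of [F = alpha + beta] at [y] in the direction [v]. *)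
Definition randers_diff p y v : R := (len p y)^-1 * g p y v + g p (Q p) v.

(** The Hessian of the Riemannian norm at [y]. *)
Definition angular p y u v : R :=
  (len p y)^-1 * g p u v - (len p y)^-1 ^+ 3 * (g p y u * g p y v).

(** The Hessian of [F ^ 2 / 2]: since [beta] is linear, the Hessian of [F] is
    that of the Riemannian norm. *)
Definition randers_tensor p y u v : R :=
  randers_diff p y u * randers_diff p y v + randers g Q p y * angular p y u v.

(** The derivative of [angular] in its base point, in the direction [u]. *)
Definition angular_diff p y u v w : R :=
  3 * (len p y)^-1 ^+ 5 * g p y u * (g p y v * g p y w)
  - (len p y)^-1 ^+ 3 * (g p y u * g p v w + g p u v * g p y w + g p y v * g p u w).

(** The derivative of [randers_tensor] in its base point, in the direction
    [u]; this is twice the Cartan tensor. *)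
Definition randers_cartan p y u v w : R :=
  angular p y u v * randers_diff p y w + randers_diff p y v * angular p y u w
  + randers_diff p y u * angular p y v w
  + randers g Q p y * angular_diff p y u v w.

Lemma is_derive_prod (f h : R -> R) (s a b : R) : is_derive s 1 f a ->
  is_derive s 1 h b -> is_derive s 1 (fun t => f t * h t) (f s * b + h s * a).
Proof. by move=> df dh; exact: is_deriveM. Qed.

Lemma is_derive_add (f h : R -> R) (s a b : R) : is_derive s 1 f a ->
  is_derive s 1 h b -> is_derive s 1 (fun t => f t + h t) (a + b).
Proof. by move=> df dh; exact: is_deriveD. Qed.

Lemma is_derive_const (s c : R) : is_derive s 1 (fun _ : R => c) 0.
Proof. exact: is_derive_cst. Qed.

Lemma is_derive_var (s : R) : is_derive s 1 (fun t : R => t) 1.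
Proof. exact: is_derive_id. Qed.

Section AtPoint.
Context {p : M} (tQ : tangent p (Q p)).

Lemma len_gt0 y : tangent p y -> y <> 0 -> 0 < len p y.
Proof. by move=> ty y0; rewrite sqrtr_gt0; exact: metric_gt0. Qed.

Lemma len_sqr y : tangent p y -> len p y ^+ 2 = g p y y.
Proof. by move=> ty; rewrite sqr_sqrtr //; exact: metric_ge0. Qed.

Lemma line0 y u : y + 0 *: u = y.
Proof. by rewrite scale0r addr0. Qed.

Lemma is_derive_metric_line y u v : tangent p y -> tangent p u -> tangent p v ->
  is_derive (0 : R) 1 (fun s => g p (y + s *: u) v) (g p u v).
Proof.
move=> ty tu tv.
have -> : (fun s => g p (y + s *: u) v) = (fun s => g p y v + s * g p u v).
  apply/funext => s; rewrite metricDl ?metricZl //; exact: tangent_scale.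
have := is_derive_add (is_derive_const 0 (g p y v))
  (is_derive_prod (is_derive_var 0) (is_derive_const 0 (g p u v))).
by move=> dE; apply: (is_derive_eq dE); ring.
Qed.

Lemma is_derive_sqnorm_line y u : tangent p y -> tangent p u ->
  is_derive (0 : R) 1 (fun s => g p (y + s *: u) (y + s *: u)) (2 * g p y u).
Proof.
move=> ty tu.
have -> : (fun s => g p (y + s *: u) (y + s *: u)) =
    (fun s => g p y y + (s * (2 * g p y u) + s * s * g p u u)).
  by apply/funext => s; rewrite metric_line // -expr2 addrA.
have := is_derive_add (is_derive_const 0 (g p y y)) (is_derive_add
  (is_derive_prod (is_derive_var 0) (is_derive_const 0 (2 * g p y u)))
  (is_derive_prod (is_derive_prod (is_derive_var 0) (is_derive_var 0))
    (is_derive_const 0 (g p u u)))).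
by move=> dE; apply: (is_derive_eq dE); ring.
Qed.

(** Lets the closed form of an inner derivative, valid away from the zero
    vector, be differentiated once more at 0. *)
Lemma line_neq0 y u : tangent p y -> y <> 0 -> tangent p u ->
  \forall s \near (0 : R), y + s *: u <> 0.
Proof.
move=> ty y0 tu; have [d _] := is_derive_sqnorm_line ty tu.
have := differentiable_continuous ((derivable1_diffP _ _).1 d).
rewrite /continuous_at /= => /cvgr_gt/(_ 0); rewrite line0 => /(_ (metric_gt0 g_riem ty y0)).
apply: filterS => s; apply: contraPnot => ->.
by rewrite metric0l ?ltxx //; exact: tangent0.
Qed.

Lemma is_derive_len y u : tangent p y -> y <> 0 -> tangent p u ->
  is_derive (0 : R) 1 (fun s => len p (y + s *: u)) ((len p y)^-1 * g p y u).
Proof.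
move=> ty y0 tu; have gy0 := metric_gt0 g_riem ty y0.
have dg := is_derive_sqnorm_line ty tu.
have ds : is_derive (g p (y + 0 *: u) (y + 0 *: u)) 1 (@Num.sqrt R)
    (2 * len p y)^-1.
  by rewrite line0; exact: is_derive1_sqrt.
apply: is_derive_eq (is_derive1_comp ds dg) _.
by field; rewrite gt_eqF // len_gt0.
Qed.

Lemma is_derive_len_inv y u : tangent p y -> y <> 0 -> tangent p u ->
  is_derive (0 : R) 1 (fun s => (len p (y + s *: u))^-1)
    (- (len p y)^-1 ^+ 3 * g p y u).
Proof.
move=> ty y0 tu; have [dl El] := is_derive_len ty y0 tu.
have l0 := len_gt0 ty y0.
have ln0 : len p (y + 0 *: u) != 0 by rewrite line0 gt_eqF.
split; first exact: derivableV.
rewrite deriveV // El line0 -[LHS]/(_ * _).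
by field; rewrite gt_eqF.
Qed.

Lemma is_derive_randers y u : tangent p y -> y <> 0 -> tangent p u ->
  is_derive (0 : R) 1 (fun s => randers g Q p (y + s *: u)) (randers_diff p y u).
Proof.
move=> ty y0 tu; apply: is_derive_add; first exact: is_derive_len.
have -> : (fun s => g p (Q p) (y + s *: u)) = (fun s => g p (y + s *: u) (Q p)).
  apply/funext => s; apply: metricC => //; apply: tangent_add => //.
  exact: tangent_scale.
by rewrite [g p (Q p) u](metricC g_riem) //; exact: is_derive_metric_line.
Qed.

Lemma is_derive_randers_diff y u v : tangent p y -> y <> 0 -> tangent p u ->
  tangent p v ->
  is_derive (0 : R) 1 (fun s => randers_diff p (y + s *: u) v) (angular p y u v).
Proof.
move=> ty y0 tu tv.
have := is_derive_add (is_derive_prod (is_derive_len_inv ty y0 tu)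
  (is_derive_metric_line ty tu tv)) (is_derive_const 0 (g p (Q p) v)).
by move=> dE; apply: (is_derive_eq dE); rewrite line0 /angular; ring.
Qed.

Lemma is_derive_angular y u v w : tangent p y -> y <> 0 -> tangent p u ->
  tangent p v -> tangent p w ->
  is_derive (0 : R) 1 (fun s => angular p (y + s *: u) v w)
    (angular_diff p y u v w).
Proof.
move=> ty y0 tu tv tw; have dl := is_derive_len_inv ty y0 tu.
have := is_derive_add (is_derive_prod dl (is_derive_const 0 (g p v w)))
  (is_derive_prod (is_derive_const 0 (-1))
  (is_derive_prod (is_derive_prod dl (is_derive_prod dl dl))
   (is_derive_prod (is_derive_metric_line ty tu tv) (is_derive_metric_line ty tu tw)))).
have -> : (fun s => angular p (y + s *: u) v w) =
  (fun s => (len p (y + s *: u))^-1 * g p v w + -1 *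
   ((len p (y + s *: u))^-1 * ((len p (y + s *: u))^-1 * (len p (y + s *: u))^-1)
    * (g p (y + s *: u) v * g p (y + s *: u) w))).
  by apply/funext => s; rewrite /angular; ring.
by move=> dE; apply: (is_derive_eq dE); rewrite line0 /angular_diff; ring.
Qed.

Lemma derive1_near_is_derive (f h : R -> R) (s a : R) :
  (\forall t \near s, h t = f t) -> is_derive s 1 h a -> derive1 f s = a.
Proof. by move=> hf /(near_eq_is_derive hf)[_ <-]; rewrite derive1E. Qed.

Lemma derive1_randers_sqr y u : tangent p y -> y <> 0 -> tangent p u ->
  derive1 (fun s : R => randers g Q p (y + s *: u) ^+ 2) 0 =
  2 * (randers g Q p y * randers_diff p y u).
Proof.
move=> ty y0 tu; have dF := is_derive_randers ty y0 tu.
apply: (@derive1_near_is_derive _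
  (fun s => randers g Q p (y + s *: u) * randers g Q p (y + s *: u))).
  by apply: (@nearW _ (nbhs (0 : R))) => s; rewrite expr2.
by apply: (is_derive_eq (is_derive_prod dF dF)); rewrite line0; ring.
Qed.

Lemma fundamental_tensor_randers y u v : tangent p y -> y <> 0 -> tangent p u ->
  tangent p v -> fundamental_tensor (randers g Q) p y u v = randers_tensor p y u v.
Proof.
move=> ty y0 tu tv; rewrite /fundamental_tensor.
rewrite [derive1 _ 0](_ : _ = 2 * randers_tensor p y u v); first by field.
apply: (@derive1_near_is_derive _ (fun s => 2 * (randers g Q p (y + s *: u) *
  randers_diff p (y + s *: u) v))).
- apply: filterS (line_neq0 ty y0 tu) => s ys0.
  by rewrite derive1_randers_sqr //; apply: tangent_add => //; exact: tangent_scale.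
- have := is_derive_prod (is_derive_const 0 2) (is_derive_prod
    (is_derive_randers ty y0 tu) (is_derive_randers_diff ty y0 tu tv)).
  by move=> dE; apply: (is_derive_eq dE); rewrite line0 /randers_tensor; ring.
Qed.

Lemma is_derive_randers_tensor y u v w : tangent p y -> y <> 0 -> tangent p u ->
  tangent p v -> tangent p w ->
  is_derive (0 : R) 1 (fun s => randers_tensor p (y + s *: u) v w)
    (randers_cartan p y u v w).
Proof.
move=> ty y0 tu tv tw.
have := is_derive_add (is_derive_prod (is_derive_randers_diff ty y0 tu tv)
  (is_derive_randers_diff ty y0 tu tw)) (is_derive_prod
  (is_derive_randers ty y0 tu) (is_derive_angular ty y0 tu tv tw)).
by move=> dE; apply: (is_derive_eq dE); rewrite line0 /randers_cartan; ring.
Qed.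

Lemma cartan_tensor_randers y u v w : tangent p y -> y <> 0 -> tangent p u ->
  tangent p v -> tangent p w ->
  2 * cartan_tensor (randers g Q) p y u v w = randers_cartan p y u v w.
Proof.
move=> ty y0 tu tv tw; rewrite /cartan_tensor.
rewrite [derive1 _ 0](_ : _ = 2 * randers_cartan p y u v w); first by field.
apply: (@derive1_near_is_derive _
  (fun s => 2 * randers_tensor p (y + s *: u) v w)).
- apply: filterS (line_neq0 ty y0 tu) => s ys0.
  rewrite -fundamental_tensor_randers //; last first.
    by apply: tangent_add => //; exact: tangent_scale.
  by rewrite /fundamental_tensor mulrA divff ?mul1r // pnatr_eq0.
- have := is_derive_prod (is_derive_const 0 2) (is_derive_randers_tensor ty y0 tu tv tw).
  by move=> dE; apply: (is_derive_eq dE); rewrite line0; ring.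
Qed.

End AtPoint.
End RandersTensors.

Section RandersDefinite.
Context {R : realType} {n : nat} {M : manifold R n}.
Context {g : metric M} (g_riem : riemannian g) {Q : vfield M} {p : M}.
Context (tQ : tangent p (Q p)).
Implicit Types (y u v w : functional M).

(** The linear part is dominated by the norm as soon as [Q] is shorter than 1,
    by the Cauchy-Schwarz inequality. *)
Lemma randers_gt0 y : g p (Q p) (Q p) < 1 -> tangent p y -> y <> 0 ->
  0 < randers g Q p y.
Proof.
move=> Q1 ty y0; have gy0 := metric_gt0 g_riem ty y0.
have l0 := len_gt0 g_riem ty y0.
have cs := metric_cauchy_schwarz g_riem ty tQ y0.
rewrite /randers -/(len g p y) ltNge; apply/negP => Fle0.
have : len g p y ^+ 2 <= g p y (Q p) ^+ 2.
  rewrite (metricC g_riem ty tQ) -[leRHS]sqrrN ler_pXn2r ?nnegrE //; lra.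
rewrite len_sqr // => /le_trans/(_ cs); rewrite -[leLHS]mulr1 ler_pM2l //.
by rewrite leNgt Q1.
Qed.

Lemma randers_diff_self y : tangent p y -> y <> 0 ->
  randers_diff g Q p y y = randers g Q p y.
Proof.
move=> ty y0; rewrite /randers_diff /randers -/(len g p y) -(len_sqr g_riem ty).
by rewrite expr2 mulKf // gt_eqF // len_gt0.
Qed.

(** The norm is homogeneous of degree 1, so the radial direction is in the
    kernel of its Hessian. *)
Lemma angular_self y u : tangent p y -> y <> 0 -> tangent p u ->
  angular g p y u y = 0.
Proof.
move=> ty y0 tu; rewrite /angular -(len_sqr g_riem ty) (metricC g_riem tu ty).
by field; rewrite gt_eqF // len_gt0.
Qed.

Lemma angularC y u v : tangent p u -> tangent p v ->
  angular g p y u v = angular g p y v u.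
Proof. by move=> tu tv; rewrite /angular (metricC g_riem tu tv) [g p y u * _]mulrC. Qed.

Lemma randers_tensorC y u v : tangent p u -> tangent p v ->
  randers_tensor g Q p y u v = randers_tensor g Q p y v u.
Proof. by move=> tu tv; rewrite /randers_tensor angularC // mulrC. Qed.

Lemma randers_tensorBl y u v w : tangent p y -> tangent p u -> tangent p v ->
  tangent p w ->
  randers_tensor g Q p y (u - v) w =
  randers_tensor g Q p y u w - randers_tensor g Q p y v w.
Proof.
move=> ty tu tv tw; rewrite /randers_tensor /randers_diff /angular.
by rewrite (metricBl g_riem) // !(metricBr g_riem) //; ring.
Qed.

Lemma randers_tensorBr y u v w : tangent p y -> tangent p u -> tangent p v ->
  tangent p w ->
  randers_tensor g Q p y w (u - v) =
  randers_tensor g Q p y w u - randers_tensor g Q p y w v.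
Proof.
move=> ty tu tv tw; have tuv := tangent_sub tu tv.
by rewrite randers_tensorC // randers_tensorBl // ![randers_tensor _ _ _ _ _ w]randers_tensorC.
Qed.

Lemma randers_cartanBl y u v w z : tangent p y -> tangent p u -> tangent p v ->
  tangent p w -> tangent p z ->
  randers_cartan g Q p y (u - v) w z =
  randers_cartan g Q p y u w z - randers_cartan g Q p y v w z.
Proof.
move=> ty tu tv tw tz.
rewrite /randers_cartan /randers_diff /angular_diff /angular.
by rewrite !(metricBl g_riem) // !(metricBr g_riem) //; ring.
Qed.

Lemma randers_cartan0 y w z : tangent p y -> tangent p w -> tangent p z ->
  randers_cartan g Q p y 0 w z = 0.
Proof.
move=> ty tw tz; have t0 := @tangent0 R n M p.
by have := randers_cartanBl ty t0 t0 tw tz; rewrite !subrr.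
Qed.

(** The fundamental tensor is homogeneous of degree 0 in its base point, so
    the Cartan tensor vanishes when one of its arguments is the base point. *)
Lemma randers_cartan_self y u v : tangent p y -> y <> 0 -> tangent p u ->
  tangent p v -> randers_cartan g Q p y u v y = 0.
Proof.
move=> ty y0 tu tv; rewrite /randers_cartan randers_diff_self // !angular_self //.
rewrite /angular_diff /angular -(len_sqr g_riem ty) (metricC g_riem tv ty) (metricC g_riem tu ty).
by field; rewrite gt_eqF // len_gt0.
Qed.

(** Definiteness of the fundamental tensor. Both terms of [randers_tensor] are
    nonnegative; the angular form vanishes only on multiples of [y], and on
    these the differential of [F] is a multiple of [F y > 0]. *)
Lemma randers_tensor_eq0 y w : g p (Q p) (Q p) < 1 -> tangent p y -> y <> 0 ->
  tangent p w -> randers_tensor g Q p y w w = 0 -> w = 0.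
Proof.
move=> Q1 ty y0 tw; have F0 := randers_gt0 Q1 ty y0.
have l0 := len_gt0 g_riem ty y0; have ln0 : len g p y != 0 by rewrite gt_eqF.
pose c := g p y w / len g p y ^+ 2.
have angE : angular g p y w w = (len g p y)^-1 * g p (w - c *: y) (w - c *: y).
  rewrite -scaleNr (metric_line g_riem) // -(len_sqr g_riem ty) (metricC g_riem tw ty).
  by rewrite /angular /c; field.
have twc : tangent p (w - c *: y) by apply: tangent_sub => //; exact: tangent_scale.
have ang0 : 0 <= angular g p y w w.
  by rewrite angE mulr_ge0 ?invr_ge0 ?(ltW l0) // (metric_ge0 g_riem).
rewrite /randers_tensor => /eqP; rewrite -expr2 paddr_eq0 ?sqr_ge0 //; last first.
  by rewrite mulr_ge0 // ltW.
rewrite sqrf_eq0 mulf_eq0 (gt_eqF F0) /= angE mulf_eq0 invr_eq0 (negPf ln0) /=.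
move=> /andP[/eqP L0 /eqP /(metric_eq0 g_riem twc) /subr0_eq wE].
move: L0; rewrite wE /randers_diff !(metricZr g_riem) // mulrCA -mulrDr.
rewrite -/(randers_diff g Q p y y) randers_diff_self // => /eqP.
by rewrite mulf_eq0 (gt_eqF F0) orbF => /eqP ->; rewrite scale0r.
Qed.

End RandersDefinite.

(** For a metric connection this says that [g (D X Q) Z = 0] for all [X] and
    [Z]; the one-form dual to [Q] is parallel. *)
Definition parallel_form (R : realType) (n : nat) (M : manifold R n)
    (g : metric M) (D : connection M) (Q : vfield M) : Prop :=
  forall X Z p, smooth_vfield X -> smooth_vfield Z ->
    X p (fun q => g q (Q q) (Z q)) = g p (Q p) (D X Z p).

Section RandersChern.
Context {R : realType} {n : nat} {M : manifold R n}.
Context {g : metric M} (g_riem : riemannian g).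
Context {D : connection M} (D_lc : levi_civita g D).
Context {Q : vfield M} (sQ : smooth_vfield Q).
Implicit Types (X Y Z V : vfield M) (p : M).

Lemma smooth_metric X Y : smooth_vfield X -> smooth_vfield Y ->
  smooth_fun (fun p => g p (X p) (Y p)).
Proof. by have [_ _ _] := g_riem; exact. Qed.

Lemma smooth_len V : smooth_vfield V -> nonvanishing V ->
  smooth_fun (fun q => len g q (V q)).
Proof.
move=> sV V0; have gV q : 0 < g q (V q) (V q).
  by apply: (metric_gt0 g_riem); [exact: sV.1|exact: V0].
rewrite (_ : (fun _ => _) = fun q => g q (V q) (V q) `^ 2^-1).
  by apply: smooth_fun_powR => //; exact: smooth_metric.
by apply/funext => q; rewrite powR12_sqrt // ltW.
Qed.

Lemma smooth_len_inv V : smooth_vfield V -> nonvanishing V ->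
  smooth_fun (fun q => (len g q (V q))^-1).
Proof.
move=> sV V0; have lV q : 0 < len g q (V q).
  by apply: (len_gt0 g_riem); [exact: sV.1|exact: V0].
rewrite (_ : (fun _ => _) = fun q => len g q (V q) `^ (-1)).
  by apply: smooth_fun_powR => //; exact: smooth_len.
by apply/funext => q; rewrite powR_inv1 // ltW.
Qed.

(** A tangent vector is only a derivation, so there is no chain rule at hand:
    the value on the norm is found by applying the Leibniz rule to its square,
    which is the smooth function [g V V]. *)
Lemma tangent_len V X p : smooth_vfield V -> nonvanishing V -> smooth_vfield X ->
  X p (fun q => len g q (V q)) = (len g p (V p))^-1 * g p (V p) (D X V p).
Proof.
move=> sV V0 sX; have [[sD _ _ _] _ comp] := D_lc.
have lV q : 0 < len g q (V q).
  by apply: (len_gt0 g_riem); [exact: sV.1|exact: V0].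
have sl := smooth_len sV V0; have tX := sX.1 p.
have := tangentM tX sl sl.
rewrite (_ : (fun q => len g q (V q) * len g q (V q)) =
  fun q => g q (V q) (V q)); last first.
  apply/funext => q; rewrite -expr2 (len_sqr g_riem) //; exact: sV.1.
have tDV := (sD _ _ sX sV).1 p; have tV := sV.1 p.
rewrite comp // (metricC g_riem tDV tV) => E.
have ln := lt0r_neq0 (lV p).
apply: (mulfI ln); rewrite mulVKf //; lra.
Qed.

Lemma tangent_len_inv V X p : smooth_vfield V -> nonvanishing V ->
  smooth_vfield X ->
  X p (fun q => (len g q (V q))^-1) =
  - (len g p (V p))^-1 ^+ 3 * g p (V p) (D X V p).
Proof.
move=> sV V0 sX; have lV q : len g q (V q) != 0.
  by rewrite gt_eqF //; apply: (len_gt0 g_riem); [exact: sV.1|exact: V0].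
have tX := sX.1 p.
have := tangentM tX (smooth_len sV V0) (smooth_len_inv sV V0).
rewrite (_ : (fun q => len g q (V q) * (len g q (V q))^-1) = fun=> 1); last first.
  by apply/funext => q; rewrite divff.
rewrite (tangent_cst _ tX) tangent_len // => E.
apply: (mulfI (lV p)).
rewrite [LHS](_ : _ = - ((len g p (V p))^-1 * ((len g p (V p))^-1 * g p (V p) (D X V p)))).
  by field.
by rewrite -[RHS]addr0 E; ring.
Qed.

(** The fundamental tensor along [V] is a polynomial in the scalar products of
    [V], [Y], [Z], in their products with [Q], and in the norm of [V] and its
    inverse. A derivation acts on each of them through [D] alone when the form
    of [Q] is parallel, so the Leibniz rule gives almost compatibility of [D]. *)
Lemma levi_civita_randers V X Y Z p : parallel_form g D Q -> smooth_vfield V ->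
  nonvanishing V -> smooth_vfield X -> smooth_vfield Y -> smooth_vfield Z ->
  X p (fun q => randers_tensor g Q q (V q) (Y q) (Z q)) =
  randers_tensor g Q p (V p) (D X Y p) (Z p) +
  randers_tensor g Q p (V p) (Y p) (D X Z p) +
  randers_cartan g Q p (V p) (D X V p) (Y p) (Z p).
Proof.
move=> par sV V0 sX sY sZ; have [[sD _ _ _] _ comp] := D_lc.
have tX := sX.1 p; have [tV tY tZ] : [/\ tangent p (V p), tangent p (Y p) & tangent p (Z p)].
  by split; [exact: sV.1|exact: sY.1|exact: sZ.1].
have [tDV tDY tDZ] : [/\ tangent p (D X V p), tangent p (D X Y p) & tangent p (D X Z p)].
  by split; apply: (sD _ _ sX _).1.
have sl := smooth_len sV V0; have si := smooth_len_inv sV V0.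
pose l q := len g q (V q); pose i q := (l q)^-1.
pose vy q := g q (V q) (Y q); pose vz q := g q (V q) (Z q).
pose yz q := g q (Y q) (Z q).
pose bv q := g q (Q q) (V q); pose by_ q := g q (Q q) (Y q); pose bz q := g q (Q q) (Z q).
have s_i : smooth_fun i := si. have s_l : smooth_fun l := sl.
have s_vy : smooth_fun vy by exact: smooth_metric.
have s_vz : smooth_fun vz by exact: smooth_metric.
have s_yz : smooth_fun yz by exact: smooth_metric.
have s_bv : smooth_fun bv by exact: smooth_metric.
have s_by : smooth_fun by_ by exact: smooth_metric.
have s_bz : smooth_fun bz by exact: smooth_metric.
pose ly q := i q * vy q + by_ q; pose lz q := i q * vz q + bz q.
pose F q := l q + bv q.
pose iii q := i q * (i q * i q).
pose h q := i q * yz q - iii q * (vy q * vz q).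
have s_ly : smooth_fun ly by apply: smooth_funD => //; exact: smooth_funM.
have s_lz : smooth_fun lz by apply: smooth_funD => //; exact: smooth_funM.
have s_F : smooth_fun F by exact: smooth_funD.
have s_ii : smooth_fun (fun q => i q * i q) by exact: smooth_funM.
have s_iii : smooth_fun iii by exact: smooth_funM.
have s_vv : smooth_fun (fun q => vy q * vz q) by exact: smooth_funM.
have s_ivv : smooth_fun (fun q => iii q * (vy q * vz q)) by exact: smooth_funM.
have s_iyz : smooth_fun (fun q => i q * yz q) by exact: smooth_funM.
have s_h : smooth_fun h by exact: smooth_funB.
have -> : (fun q => randers_tensor g Q q (V q) (Y q) (Z q)) =
    (fun q => ly q * lz q + F q * h q).
  apply/funext => q; rewrite /randers_tensor /randers_diff /angular /randers.
  rewrite -/(len g q (V q)) /ly /lz /F /h /iii /vy /vz /yz /bv /by_ /bz /i /l.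
  by ring.
rewrite (tangentD tX); [|exact: smooth_funM..].
rewrite !(tangentM tX) //.
have -> : X p ly = i p * X p vy + vy p * X p i + X p by_.
  by rewrite (tangentD tX) ?(tangentM tX) //; exact: smooth_funM.
have -> : X p lz = i p * X p vz + vz p * X p i + X p bz.
  by rewrite (tangentD tX) ?(tangentM tX) //; exact: smooth_funM.
have -> : X p F = X p l + X p bv by rewrite (tangentD tX).
have -> : X p h = (i p * X p yz + yz p * X p i) - (iii p * (vy p * X p vz + vz p * X p vy)
     + vy p * vz p * (i p * (i p * X p i + i p * X p i) + i p * i p * X p i)).
  rewrite /h -mulN1r.
  have -> : (fun q => i q * yz q - iii q * (vy q * vz q)) =
      (fun q => i q * yz q + -1 * (iii q * (vy q * vz q))).
    by apply/funext => q; rewrite mulN1r.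
  rewrite (tangentD tX) // ?(tangentZ _ tX) //; last exact: smooth_funZ.
  by rewrite !(tangentM tX).
rewrite /bv /by_ /bz !par // /vy /vz /yz !comp // /i /l tangent_len // tangent_len_inv //.
rewrite /ly /lz /F /h /iii /vy /vz /yz /bv /by_ /bz /i /l.
rewrite /randers_cartan /randers_tensor /angular_diff /angular /randers_diff /randers.
rewrite -/(len g p (V p)) (metricC g_riem tDV tY) (metricC g_riem tDV tZ).
by ring.
Qed.

End RandersChern.

(** * The Chern connection of a Randers metric of Berwald type *)

Section ChernUniqueness.
Context {R : realType} {n : nat} {M : manifold R n}.
Context {g : metric M} (g_riem : riemannian g).
Context {D : connection M} (D_lc : levi_civita g D).
Context {Q : vfield M} (sQ : smooth_vfield Q).
Context (Q_lt1 : forall p, g p (Q p) (Q p) < 1) (par : parallel_form g D Q).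
Implicit Types (X Y Z V : vfield M) (p : M).

(** Uniqueness of the Chern connection, applied to [nab V] and to the
    Levi-Civita connection, which satisfies the same axioms. The difference [T]
    is symmetric and satisfies [G (T X Y) Z + G Y (T X Z) + C (T X V) Y Z = 0]
    for the fundamental tensor [G] and the form [C = 2 * Cartan]. The Cartan
    tensor vanishes on [V], so taking [V] among the arguments gives in turn
    [T V V = 0] and [T X V = 0]. Then the Cartan term disappears altogether and
    a form symmetric in its first two arguments and skew in the last two is 0,
    as for Levi-Civita connections. Testing with the field [T X Y] itself and
    using definiteness makes any appeal to local frames unnecessary. *)
Lemma chern_connection_berwald (nab : vfield M -> connection M) V X Y :
  chern_connection (randers g Q) nab -> smooth_vfield V -> nonvanishing V ->
  smooth_vfield X -> smooth_vfield Y -> nab V X Y = D X Y.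
Proof.
move=> nabP sV V0; have [[sN _ _ _] torN compN] := nabP V sV V0.
have [[sD _ _ _] torD _] := D_lc.
pose T X Y := nab V X Y - D X Y.
have sT X1 Y1 : smooth_vfield X1 -> smooth_vfield Y1 -> smooth_vfield (T X1 Y1).
  by move=> sX sY; apply: smooth_vfieldB; [exact: sN|exact: sD].
have symT X1 Y1 : smooth_vfield X1 -> smooth_vfield Y1 -> T X1 Y1 = T Y1 X1.
  move=> sX sY; have := torN _ _ sX sY; rewrite -(torD _ _ sX sY) /T => E.
  move/eqP: E; rewrite subr_eq => /eqP ->.
  by rewrite addrAC [X in X + _ = _]addrAC subrr add0r addrC.
pose G p := randers_tensor g Q p (V p).
pose C p := randers_cartan g Q p (V p).
have tv X1 p : smooth_vfield X1 -> tangent p (X1 p) by move=> sX; exact: sX.1.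
have GC p X1 Y1 : smooth_vfield X1 -> smooth_vfield Y1 ->
    G p (X1 p) (Y1 p) = G p (Y1 p) (X1 p).
  by move=> sX sY; apply: (randers_tensorC g_riem (Q := Q)); exact: tv.
have G0 X1 p : smooth_vfield X1 -> G p (X1 p) (X1 p) = 0 -> X1 p = 0.
  move=> sX; apply: (randers_tensor_eq0 g_riem); try exact: tv; last exact: V0.
  exact: Q_lt1.
have main X1 Y1 Z1 p : smooth_vfield X1 -> smooth_vfield Y1 -> smooth_vfield Z1 ->
    G p (T X1 Y1 p) (Z1 p) + G p (Y1 p) (T X1 Z1 p) + C p (T X1 V p) (Y1 p) (Z1 p) = 0.
  move=> sX sY sZ; have := compN X1 Y1 Z1 p sX sY sZ.
  have [sNY sNZ sNV] : [/\ smooth_vfield (nab V X1 Y1), smooth_vfield (nab V X1 Z1)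
     & smooth_vfield (nab V X1 V)] by split; exact: sN.
  have [sDY sDZ sDV] : [/\ smooth_vfield (D X1 Y1), smooth_vfield (D X1 Z1)
     & smooth_vfield (D X1 V)] by split; exact: sD.
  have -> : (fun q => fundamental_tensor (randers g Q) q (V q) (Y1 q) (Z1 q)) =
      (fun q => randers_tensor g Q q (V q) (Y1 q) (Z1 q)).
    by apply/funext => q; apply: (fundamental_tensor_randers g_riem); try exact: tv; exact: V0.
  rewrite !(fundamental_tensor_randers g_riem); try exact: tv; try exact: V0.
  rewrite (cartan_tensor_randers g_riem); try exact: tv; last exact: V0.
  rewrite (levi_civita_randers g_riem D_lc sQ) // => E.
  rewrite /G /C /T -![(_ - _ : vfield M) p]/(_ p - _ p).
  rewrite (randers_tensorBl g_riem); try exact: tv.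
  rewrite (randers_tensorBr g_riem); try exact: tv.
  rewrite (randers_cartanBl g_riem); try exact: tv.
  lra.
have CV p X1 Y1 : smooth_vfield X1 -> smooth_vfield Y1 -> C p (X1 p) (Y1 p) (V p) = 0.
  by move=> sX sY; apply: (randers_cartan_self g_riem); try exact: tv; exact: V0.
have C0 p Y1 Z1 : smooth_vfield Y1 -> smooth_vfield Z1 -> C p 0 (Y1 p) (Z1 p) = 0.
  by move=> sY sZ; apply: (randers_cartan0 g_riem); exact: tv.
have S1 X1 p : smooth_vfield X1 -> G p (T X1 V p) (V p) = 0.
  move=> sX; have sTX := sT _ _ sX sV.
  have := main X1 V V p sX sV sV; rewrite CV // [G p (V p) _]GC //; lra.
have S2 X1 Y1 p : smooth_vfield X1 -> smooth_vfield Y1 ->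
    G p (T X1 Y1 p) (V p) + G p (Y1 p) (T X1 V p) = 0.
  move=> sX sY; have := main X1 Y1 V p sX sY sV; rewrite CV // ?addr0 //.
  exact: sT.
(* By symmetry [T V Y = T Y V], which is G-orthogonal to V. *)
have TVV p : T V V p = 0.
  apply: G0; first exact: sT.
  have sTT := sT _ _ sV sV; have := S2 V _ p sV sTT.
  by rewrite symT // S1 // add0r.
have S4 Y1 Z1 p : smooth_vfield Y1 -> smooth_vfield Z1 ->
    G p (T V Y1 p) (Z1 p) + G p (Y1 p) (T V Z1 p) = 0.
  by move=> sY sZ; have := main V Y1 Z1 p sV sY sZ; rewrite TVV C0 // addr0.
(* The form [G Y (T X V)] is symmetric in X and Y by S2, and skew by S4. *)
have TXV X1 p : smooth_vfield X1 -> T X1 V p = 0.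
  move=> sX; have sTX := sT _ _ sX sV; apply: G0 => //.
  have e1 := S2 X1 _ p sX sTX; have e2 := S2 _ X1 p sTX sX.
  have e3 := S4 X1 _ p sX sTX.
  rewrite (symT _ _ sTX sX) in e2; rewrite (symT V X1) // (symT V (T X1 V)) // in e3.
  lra.
have S6 X1 Y1 Z1 p : smooth_vfield X1 -> smooth_vfield Y1 -> smooth_vfield Z1 ->
    G p (T X1 Y1 p) (Z1 p) = - G p (T X1 Z1 p) (Y1 p).
  move=> sX sY sZ; have := main X1 Y1 Z1 p sX sY sZ; rewrite TXV // C0 //.
  by rewrite [G p (Y1 p) _]GC //; [lra|exact: sT].
move=> sX sY; apply/subr0_eq/funext => p; have sTT := sT _ _ sX sY.
apply: (G0 _ _ sTT).
have e : G p (T X Y p) (T X Y p) = - G p (T X Y p) (T X Y p).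
  rewrite {1}S6 // [T X (T X Y)]symT // S6 // opprK.
  rewrite [T (T X Y) Y]symT // S6 //.
  by rewrite [T Y X]symT.
lra.
Qed.

End ChernUniqueness.

(** * Curvature of the Levi-Civita connection *)

Section Curvature.
Context {R : realType} {n : nat} {M : manifold R n}.
Context {g : metric M} (g_riem : riemannian g).
Context {D : connection M} (D_lc : levi_civita g D).
Implicit Types (X Y Z U V : vfield M) (p : M).

Lemma smooth_bracket X Y : smooth_vfield X -> smooth_vfield Y ->
  smooth_vfield (bracket X Y).
Proof.
move=> sX sY; have [[sD _ _ _] tor _] := D_lc.
by rewrite -tor //; apply: smooth_vfieldB; exact: sD.
Qed.

Lemma smooth_curvature U V Z : smooth_vfield U -> smooth_vfield V ->
  smooth_vfield Z -> smooth_vfield (curvature D U V Z).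
Proof.
move=> sU sV sZ; have [[sD _ _ _] _ _] := D_lc.
have sB := smooth_bracket sU sV.
apply: smooth_vfieldB; last exact: sD.
by apply: smooth_vfieldB; apply: (sD) => //; exact: sD.
Qed.

Lemma metric_curvature U V Z p w : smooth_vfield U -> smooth_vfield V ->
  smooth_vfield Z -> tangent p w ->
  g p w (curvature D U V Z p) =
  g p w (D U (D V Z) p) - g p w (D V (D U Z) p) - g p w (D (bracket U V) Z p).
Proof.
move=> sU sV sZ tw; have [[sD _ _ _] _ _] := D_lc.
have sB := smooth_bracket sU sV.
have tUV : tangent p (D U (D V Z) p) by apply: (sD _ _ _ _).1 => //; exact: sD.
have tVU : tangent p (D V (D U Z) p) by apply: (sD _ _ _ _).1 => //; exact: sD.
have tB : tangent p (D (bracket U V) Z p) by apply: (sD _ _ _ _).1.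
rewrite /curvature -[(_ - _ - _ : vfield M) p]/(_ p - _ p - _ p).
by rewrite !(metricBr g_riem) //; exact: tangent_sub.
Qed.

(** Differentiate the function [g Q Z] twice: by parallelism all derivatives
    fall on [Z], and the commutator of [U] and [V] minus the bracket is 0 on
    functions. *)
Lemma curvature_parallel Q U V Z p : smooth_vfield Q -> parallel_form g D Q ->
  smooth_vfield U -> smooth_vfield V -> smooth_vfield Z ->
  g p (Q p) (curvature D U V Z p) = 0.
Proof.
move=> sQ par sU sV sZ; have [[sD _ _ _] _ _] := D_lc.
have sB := smooth_bracket sU sV.
have [sUZ sVZ] : smooth_vfield (D U Z) /\ smooth_vfield (D V Z) by split; exact: sD.
pose f q := g q (Q q) (Z q).
have E : bracket U V p f = U p (fun q => V q f) - V p (fun q => U q f) by [].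
have Vf : (fun q => V q f) = (fun q => g q (Q q) (D V Z q)).
  by apply/funext => q; exact: par.
have Uf : (fun q => U q f) = (fun q => g q (Q q) (D U Z q)).
  by apply/funext => q; exact: par.
move: E; rewrite Vf Uf /f !par // => E.
by rewrite metric_curvature // ?E ?subrr //; exact: sQ.1.
Qed.

(** The same computation for the function [g Z Z], on which the mixed terms
    cancel by symmetry of the metric. *)
Lemma curvature_skew U V Z p : smooth_vfield U -> smooth_vfield V ->
  smooth_vfield Z -> g p (Z p) (curvature D U V Z p) = 0.
Proof.
move=> sU sV sZ; have [[sD _ _ _] _ comp] := D_lc.
have sB := smooth_bracket sU sV.
have [sUZ sVZ] : smooth_vfield (D U Z) /\ smooth_vfield (D V Z) by split; exact: sD.
pose f q := g q (Z q) (Z q).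
have E : bracket U V p f = U p (fun q => V q f) - V p (fun q => U q f) by [].
have df X q : smooth_vfield X -> X q f = 2 * g q (Z q) (D X Z q).
  move=> sX; rewrite /f comp // (metricC g_riem (u := D X Z q)).
  - by ring.
  - by apply: (sD _ _ _ _).1.
  - exact: sZ.1.
have Vf : (fun q => V q f) = (fun q => 2 * g q (Z q) (D V Z q)).
  by apply/funext => q; exact: df.
have Uf : (fun q => U q f) = (fun q => 2 * g q (Z q) (D U Z q)).
  by apply/funext => q; exact: df.
move: E; rewrite Vf Uf df // (tangentZ _ (sU.1 p)); last exact: smooth_metric.
rewrite (tangentZ _ (sV.1 p)); last exact: smooth_metric.
rewrite !comp // metric_curvature //; last exact: sZ.1.
rewrite (metricC g_riem (sUZ.1 p) (sVZ.1 p)); lra.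
Qed.

End Curvature.

(** * Orthonormal frames and parallel fields *)

Section OrthonormalFrames.
Context {R : realType} {n : nat} {M : manifold R n}.
Context {g : metric M} (g_riem : riemannian g).
Implicit Types (p : M) (w : functional M) (X Y Z : vfield M).

Lemma tangent_comb_sum m p (k : 'I_m -> R) (s : 'I_m -> functional M) :
  (forall i, tangent p (s i)) -> tangent p (\sum_i k i *: s i).
Proof.
move=> ts; elim/big_ind: _ => [|u v|i _]; first exact: tangent0.
  exact: tangent_add.
exact: tangent_scale.
Qed.

Lemma metric_suml m p (k : 'I_m -> R) (s : 'I_m -> functional M) w :
  (forall i, tangent p (s i)) -> tangent p w ->
  g p (\sum_i k i *: s i) w = \sum_i k i * g p (s i) w.
Proof.
move=> ts tw; elim: m k s ts => [|m IH] k s ts.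
  by rewrite !big_ord0 metric0l.
rewrite !big_ord_recr /= metricDl //; last 2 first.
- by apply: tangent_comb_sum => i; exact: ts.
- exact: tangent_scale.
by rewrite IH // metricZl.
Qed.

(** Orthonormal vectors are independent, so the dependence relation between
    them and [w] involves [w]; orthogonality kills all the other coefficients. *)
Lemma orthonormal_tangent_complete p (s : 'I_n -> functional M) w :
  (forall i, tangent p (s i)) -> (forall i j, g p (s i) (s j) = (i == j)%:R) ->
  tangent p w -> (forall i, g p w (s i) = 0) -> w = 0.
Proof.
move=> ts ons tw ws.
(* The vector w is listed first, followed by the frame. *)
pose s' (i : 'I_n.+1) := if unlift ord0 i is Some j then s j else w.
have ts' i : tangent p (s' i) by rewrite /s'; case: unliftP => [j|] _.
have [k [k0 sum0]] := tangent_dependent ts'.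
have kS j : k (lift ord0 j) = 0.
  have := metric_suml k ts' (ts j); rewrite sum0 metric0l //.
  rewrite big_ord_recl /s' unlift_none ws mulr0 add0r (bigD1 j) //= liftK ons eqxx mulr1.
  rewrite big1 ?addr0 // => i ij; rewrite liftK ons; case: eqP ij => // *.
  by rewrite mulr0.
have [k00|kn0] := eqVneq (k ord0) 0.
  case: k0 => i; case: (unliftP ord0 i) => [j ->|->]; first by rewrite kS eqxx.
  by rewrite k00 eqxx.
move: sum0; rewrite big_ord_recl /s' unlift_none big1 ?addr0 => [|j _].
  by move=> /eqP; rewrite scaler_eq0 (negPf kn0) => /eqP.
by rewrite kS scale0r.
Qed.

Context {D : connection M} (D_lc : levi_civita g D).
Context {E : 'I_n -> vfield M} (sE : forall i, smooth_vfield (E i)).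
Context (onE : forall p i j, g p (E i p) (E j p) = (i == j)%:R).

Lemma frame_expansion X : smooth_vfield X ->
  X = \sum_i fscale (fun p => g p (X p) (E i p)) (E i).
Proof.
move=> sX; apply/funext => p.
have -> : (\sum_i fscale (fun p => g p (X p) (E i p)) (E i)) p =
    \sum_i g p (X p) (E i p) *: E i p.
  by elim/big_rec2: _ => // i u v _ <-.
have tX := sX.1 p; have tE i := (sE i).1 p.
have tS : tangent p (\sum_i g p (X p) (E i p) *: E i p) by exact: tangent_comb_sum.
apply/subr0_eq/(orthonormal_tangent_complete (s := fun i => E i p)) => //.
  exact: tangent_sub.
move=> j; rewrite metricBl // metric_suml // (bigD1 j) //= onE eqxx mulr1.
rewrite big1 ?addr0 ?subrr // => i ij; rewrite onE; case: eqP ij => // *.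
by rewrite mulr0.
Qed.

Lemma connection0l Y : smooth_vfield Y -> D 0 Y = 0.
Proof.
move=> sY; have [[_ linD _ _] _ _] := D_lc.
have s0 : smooth_vfield (0 : vfield M).
  by split=> [p|f sf]; [exact: tangent0|exact: smooth_fun_cst].
have sc1 := @smooth_fun_cst R n M 1.
have := linD _ _ _ _ sc1 s0 s0 sY.
have fs1 (Z : vfield M) : fscale (fun=> 1) Z = Z.
  by apply/funext => p; rewrite /fscale scale1r.
rewrite !fs1 addr0 => /eqP; rewrite -subr_eq0 opprD addrA subrr sub0r oppr_eq0.
by move=> /eqP.
Qed.

(** Tensoriality of the connection in its first argument. *)
Lemma frame_parallel Y : smooth_vfield Y -> (forall i, D (E i) Y = 0) ->
  forall X, smooth_vfield X -> D X Y = 0.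
Proof.
move=> sY DE X sX; have [[_ linD _ _] _ _] := D_lc.
have sXE i : smooth_fun (fun p => g p (X p) (E i p)) by exact: smooth_metric.
rewrite (frame_expansion sX).
(* Smoothness of the partial sums is carried along the induction, as additivity
   of the connection is only granted for smooth fields. *)
suff [] : smooth_vfield (\sum_i fscale (fun p => g p (X p) (E i p)) (E i)) /\
  D (\sum_i fscale (fun p => g p (X p) (E i p)) (E i)) Y = 0 by [].
elim/big_rec: _ => [|i Z _ [sZ DZ]].
  split; last exact: connection0l.
  by split=> [p|f sf]; [exact: tangent0|exact: smooth_fun_cst].
split; first by apply: smooth_vfieldD => //; exact: smooth_vfield_fscale.
by rewrite linD // DE DZ addr0; apply/funext => p; rewrite /fscale scaler0.
Qed.

(** The Koszul formula for an orthonormal frame reduces to the brackets. The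
    coefficient of [D (E i) (E c)] on [E k] is a combination of the scalar
    products of [E c], [E i], [E k] with the brackets of the two others, all of
    which vanish when [E c] is central and orthogonal to the brackets. *)
Lemma central_parallel (c : 'I_n) : (forall i, bracket (E i) (E c) = 0) ->
  (forall i j p, g p (bracket (E i) (E j) p) (E c p) = 0) ->
  forall X, smooth_vfield X -> D X (E c) = 0.
Proof.
move=> Ec cE; apply: frame_parallel => // i.
have [[sD _ _ _] tor comp] := D_lc; apply/funext => p.
have tD j k q : tangent q (D (E j) (E k) q) by apply: (sD _ _ _ _).1.
have tE j q : tangent q (E j q) := (sE j).1 q.
pose G j k l := g p (D (E j) (E k) p) (E l p).
have skew j k l : G j k l + G j l k = 0.
  rewrite /G (metricC g_riem (tD j l p) (tE k p)) -comp //.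
  under eq_fun do rewrite onE.
  exact: tangent_cst (tE j p).
have torG j k l : G j k l - G k j l = g p (bracket (E j) (E k) p) (E l p).
  by rewrite -tor // /G -metricBl.
apply: (orthonormal_tangent_complete (s := fun i => E i p)) => // k.
rewrite -/(G i c k).
have b0 j l : g p (bracket (E j) (E c) p) (E l p) = 0.
  by rewrite Ec metric0l.
have := skew i c k; have := skew i k c; have := skew c i k; have := skew k c i.
have := torG i c k; have := torG k c i; have := torG k i c; have := torG i k c.
rewrite !b0 !cE; lra.
Qed.

End OrthonormalFrames.

(** * Left invariant fields and bases of planes *)

Section LieGroup.
Context {R : realType} {n : nat} {N : lie_group R n}.
Implicit Types (X Y : vfield N) (x p : N).

Lemma lg_mulg1 x : lg_mul x (lg_one N) = x.
Proof.
have mulKV (y z : N) : lg_mul (lg_inv y) (lg_mul y z) = z.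
  by rewrite lg_mulA lg_mulVg lg_mul1g.
have invmul (y : N) : lg_mul y (lg_inv y) = lg_one N.
  by rewrite -[LHS](mulKV (lg_inv y)) [X in lg_mul _ X]mulKV lg_mulVg.
by rewrite -(lg_mulVg x) lg_mulA invmul lg_mul1g.
Qed.

Lemma lie_algebraD X Y : lie_algebra N X -> lie_algebra N Y ->
  lie_algebra N (X + Y).
Proof.
move=> [sX lX] [sY lY]; split=> [|x p]; first exact: smooth_vfieldD.
by rewrite -[LHS]/(X _ + Y _) lX lY.
Qed.

Lemma lie_algebraZ (a : R) X : lie_algebra N X -> lie_algebra N (a *: X).
Proof.
move=> [sX lX]; split=> [|x p]; first exact: smooth_vfieldZ.
by rewrite -[LHS]/(a *: X _) lX.
Qed.

Lemma left_invariant_metric_cst (g : metric N) X Y p :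
  left_invariant_metric g -> lie_algebra N X -> lie_algebra N Y ->
  g p (X p) (Y p) = g (lg_one N) (X (lg_one N)) (Y (lg_one N)).
Proof.
move=> lg [[tX _] lX] [[tY _] lY].
by rewrite -[in LHS](lg_mulg1 p) lX lY lg.
Qed.

End LieGroup.

Section LinearAlgebra.
Context {R : realType} {V : lmodType R}.
Implicit Types (u v w : V) (s : seq V).

Lemma mem_lin_span s i : (i < size s)%N -> lin_span s s`_i.
Proof.
move=> si; exists (fun j => (j == Ordinal si)%:R).
rewrite (bigD1 (Ordinal si)) //= eqxx scale1r big1 ?addr0 // => j /negPf ->.
by rewrite scale0r.
Qed.

Lemma lin_span2P u v w : lin_span [:: u; v] w <-> exists x y : R, w = x *: u + y *: v.
Proof.
split=> [[a ->]|[x [y ->]]].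
  exists (a ord0), (a (lift ord0 ord0)).
  by rewrite big_ord_recl big_ord_recl big_ord0 addr0.
exists (fun i => if i == ord0 then x else y).
by rewrite big_ord_recl big_ord_recl big_ord0 addr0.
Qed.

Lemma lin_indep2P u v : lin_indep [:: u; v] <->
  forall x y : R, x *: u + y *: v = 0 -> x = 0 /\ y = 0.
Proof.
split=> [ind x y xy0|ind a].
  have := ind (fun i => if i == ord0 then x else y).
  rewrite big_ord_recl big_ord_recl big_ord0 addr0 => /(_ xy0) a0.
  by split; [exact: a0 ord0|exact: a0 (lift ord0 ord0)].
rewrite big_ord_recl big_ord_recl big_ord0 addr0 => /ind[a0 a1] i.
by case: (unliftP ord0 i) => [j ->|->//]; rewrite (ord1 j).
Qed.

Lemma is_basis2C (P : set V) u v : is_basis P [:: u; v] -> is_basis P [:: v; u].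
Proof.
move=> [-> /lin_indep2P ind]; split.
  by apply/seteqP; split=> w /lin_span2P[x [y ->]]; apply/lin_span2P;
    exists y, x; rewrite addrC.
by apply/lin_indep2P => x y; rewrite addrC => /ind[].
Qed.

End LinearAlgebra.

(** * The flag curvature *)

Section RandersFlagCurvature.
Context {R : realType} {n : nat} {M : manifold R n}.
Context {g : metric M} (g_riem : riemannian g).
Context {D : connection M} (D_lc : levi_civita g D).
Context {Q : vfield M} (sQ : smooth_vfield Q).
Context (Q_lt1 : forall p, g p (Q p) (Q p) < 1) (par : parallel_form g D Q).
Context {nab : vfield M -> connection M}.
Context (nab_chern : chern_connection (randers g Q) nab).

(** Let [W] be the curvature vector. It is orthogonal to [Y] and to [Q], so
    the differential of [F] at [Y] vanishes on [W] and the numerator is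
    [F * g W U]. The determinant in the denominator is [F ^+ 3] times the
    Riemannian one: [Y] has norm [F] for the fundamental tensor, and after
    elimination of the differential part of [U] there remains [F] times the
    angular form. The identity holds even when the determinant is 0. *)
Lemma randers_flag_quotient (U Y : vfield M) p :
  smooth_vfield U -> smooth_vfield Y -> nonvanishing Y ->
  g p (Y p) (Y p) = 1 ->
  let gY := fundamental_tensor (randers g Q) p (Y p) in
  gY (curvature (nab Y) U Y Y p) (U p) /
    (gY (Y p) (Y p) * gY (U p) (U p) - gY (Y p) (U p) ^+ 2) =
  g p (curvature D U Y Y p) (U p) /
    (g p (Y p) (Y p) * g p (U p) (U p) - g p (Y p) (U p) ^+ 2) /
  randers g Q p (Y p) ^+ 2.
Proof.
move=> sU sY Y0 Yp1 /=; have [[sD _ _ _] _ _] := D_lc.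
have nabE (X Z : vfield M) : smooth_vfield X -> smooth_vfield Z -> nab Y X Z = D X Z.
  exact: (chern_connection_berwald g_riem D_lc sQ Q_lt1 par nab_chern).
have sB := smooth_bracket D_lc sU sY.
have -> : curvature (nab Y) U Y Y = curvature D U Y Y.
  by rewrite /curvature !nabE //; exact: sD.
have sW := smooth_curvature D_lc sU sY sY.
have tW : tangent p (curvature D U Y Y p) by exact: sW.1.
have [tU tY tQ] : [/\ tangent p (U p), tangent p (Y p) & tangent p (Q p)].
  by split; [exact: sU.1|exact: sY.1|exact: sQ.1].
have YW : g p (Y p) (curvature D U Y Y p) = 0.
  exact: (curvature_skew g_riem D_lc).
have QW : g p (Q p) (curvature D U Y Y p) = 0.
  exact: (curvature_parallel g_riem D_lc p sQ par).
have l1 : len g p (Y p) = 1 by rewrite /len Yp1 sqrtr1.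
have F0 := randers_gt0 g_riem tQ (Q_lt1 p) tY (Y0 p).
rewrite !(fundamental_tensor_randers g_riem tQ) //; try exact: Y0.
have LY := randers_diff_self g_riem (Q := Q) tY (Y0 p).
rewrite /randers_tensor LY /angular l1 /randers_diff l1 YW QW Yp1.
set F := randers g Q p (Y p) in F0 *.
set W := g p (curvature D U Y Y p) (U p).
set yu := g p (Y p) (U p); set uu := g p (U p) (U p).
rewrite invr1 expr1n.
rewrite [X in X / _ = _](_ : _ = F * W); last by ring.
rewrite [X in _ / X = _](_ : _ = F ^+ 3 * (1 * uu - yu ^+ 2)); last by ring.
have Fn : F != 0 by rewrite gt_eqF.
(* The inverse of the determinant is treated as an atom: it may be 0. *)
by rewrite invfM; move: (_ - _)^-1 => den; field.
Qed.

End RandersFlagCurvature.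

Theorem proposition5p1 (R : realType) (N : lie_group R 5)
    (N_simply_connected : simply_connected R N)
    (N_two_step : two_step_nilpotent N)
    (g : metric N) (g_riemannian : riemannian g)
    (g_left_invariant : left_invariant_metric g)
    (e1 e2 e3 e4 e5 : vfield N)
    (e_basis : is_basis (lie_algebra N) [:: e1; e2; e3; e4; e5])
    (e_orthonormal : is_orthonormal (g (lg_one N))
       [:: e1 (lg_one N); e2 (lg_one N); e3 (lg_one N); e4 (lg_one N);
           e5 (lg_one N)])
    (lambda : R) (lambda_gt0 : 0 < lambda)
    (bracket_e12 : bracket e1 e2 = lambda *: e3)
    (bracket_e : forall i j, (i < j < 5)%N -> (i, j) <> (0%N, 1%N) ->
       bracket [:: e1; e2; e3; e4; e5]`_i [:: e1; e2; e3; e4; e5]`_j = 0)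
    (center_basis : is_basis (lie_center N) [:: e3; e4; e5])
    (q1 q2 : R) (q_gt0 : 0 < Num.sqrt (q1 ^+ 2 + q2 ^+ 2))
    (q_lt1 : Num.sqrt (q1 ^+ 2 + q2 ^+ 2) < 1)
    (D : connection N) (D_levi_civita : levi_civita g D)
    (nab : vfield N -> connection N)
    (nab_chern : chern_connection (randers g (q1 *: e4 + q2 *: e5)) nab)
    (P : set (functional N))
    (P_subset : P `<=` tangent (lg_one N))
    (P_plane : exists u v, is_basis P [:: u; v])
    (a b c d f : R) (A B : functional N)
    (A_def : A = a *: e1 (lg_one N) + b *: e2 (lg_one N) + c *: e3 (lg_one N)
               + d *: e4 (lg_one N) + f *: e5 (lg_one N))
    (A_in_P : P A)
    (A_unit : Num.sqrt (g (lg_one N) A A) = 1)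
    (B_in_P : P B)
    (AB_orthonormal : is_orthonormal (g (lg_one N)) [:: A; B])
    (AB_basis : is_basis P [:: A; B])
    (KR : R)
    (KR_sectional :
       is_sectional_curvature g D (lg_one N) (lin_span [:: A; B]) KR) :
  is_flag_curvature (randers g (q1 *: e4 + q2 *: e5)) nab (lg_one N) P A
    (KR / (1 + q1 * d + q2 * f) ^+ 2).
Proof.
pose one := lg_one N.
pose Es := [:: e1; e2; e3; e4; e5].
pose E (i : 'I_5) := Es`_i.
have lE (i : 'I_5) : lie_algebra N (E i).
  by rewrite e_basis.1; exact: mem_lin_span.
have l1 : lie_algebra N e1 := lE (@Ordinal 5 0 isT).
have l2 : lie_algebra N e2 := lE (@Ordinal 5 1 isT).
have l3 : lie_algebra N e3 := lE (@Ordinal 5 2 isT).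
have l4 : lie_algebra N e4 := lE (@Ordinal 5 3 isT).
have l5 : lie_algebra N e5 := lE (@Ordinal 5 4 isT).
have onE p i j : g p (E i p) (E j p) = (i == j)%:R.
  rewrite (left_invariant_metric_cst p g_left_invariant) //.
  have := e_orthonormal i j (ltn_ord i) (ltn_ord j).
  have oneE (k : 'I_5) : [:: e1 one; e2 one; e3 one; e4 one; e5 one]`_k = E k one.
    by case: k => -[|[|[|[|[|k]]]]].
  by rewrite !oneE.
have sE i : smooth_vfield (E i) := (lE i).1.
have bracketN X Y : bracket X Y = - bracket Y X :> vfield N.
  by apply/funext => p; apply/funext => h; rewrite -[RHS]/(- (Y p _ - X p _)) opprB.
have bracketE i j : exists r : R, bracket (E i) (E j) = r *: e3.
  have lt_case (k l : 'I_5) : (k < l)%N -> exists r : R, bracket (E k) (E l) = r *: e3.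
    move=> kl; case: (pselect ((nat_of_ord k, nat_of_ord l) = (0%N, 1%N))) => [[k0 l1']|kl01].
      by exists lambda; rewrite /E k0 l1'.
    by exists 0; rewrite scale0r; apply: bracket_e => //; rewrite kl ltn_ord.
  have [/lt_case//|/lt_case[r ji]|/ord_inj ij] := ltngtP i j.
    by exists (- r); rewrite bracketN ji scaleNr.
  exists 0; rewrite scale0r ij; apply/funext => p; apply/funext => h.
  by rewrite /bracket subrr.
(* Only e3 occurs in the brackets, so a central basis field other than e3 is
   orthogonal to all of them. *)
have par_central (k : 'I_5) : lie_center N (E k) -> (k != 2 :> nat) ->
    forall X, smooth_vfield X -> D X (E k) = 0.
  move=> [_ Zk] k2; apply: (central_parallel g_riemannian D_levi_civita sE onE).
    by move=> i; exact: Zk.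
  move=> i j p; have [r ->] := bracketE i j.
  rewrite -[(_ *: _ : vfield N) p]/(r *: e3 p) (metricZl g_riemannian).
  - have := onE p (@Ordinal 5 2 isT) k; rewrite /E /= => ->.
    by rewrite -val_eqE /= eq_sym (negPf k2) mulr0.
  - exact: l3.1.1.
  - exact: (sE k).1.
have D4 : forall X, smooth_vfield X -> D X e4 = 0.
  apply: (par_central (@Ordinal 5 3 isT)) => //.
  by rewrite center_basis.1; exact: (@mem_lin_span _ _ [:: e3; e4; e5] 1).
have D5 : forall X, smooth_vfield X -> D X e5 = 0.
  apply: (par_central (@Ordinal 5 4 isT)) => //.
  by rewrite center_basis.1; exact: (@mem_lin_span _ _ [:: e3; e4; e5] 2).
pose Q : vfield N := q1 *: e4 + q2 *: e5.
have lQ : lie_algebra N Q by apply: lie_algebraD; exact: lie_algebraZ.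
have sQ : smooth_vfield Q := lQ.1.
have [[_ _ linDr leib] _ comp] := D_levi_civita.
have DQ X : smooth_vfield X -> D X Q = 0.
  have DZ (r : R) Y : smooth_vfield X -> smooth_vfield Y -> D X Y = 0 ->
      D X (r *: Y) = 0.
    move=> sX sY XY; have sr := @smooth_fun_cst R 5 N r.
    rewrite -[r *: Y]/(fscale (fun=> r) Y) leib // XY; apply/funext => p.
    rewrite /fscale -[LHS]/(X p (fun=> r) *: Y p + r *: 0) (tangent_cst _ (sX.1 p)).
    by rewrite scale0r scaler0 addr0.
  move=> sX; have [s4 s5] : smooth_vfield (q1 *: e4) /\ smooth_vfield (q2 *: e5).
    by split; apply: smooth_vfieldZ; [exact: l4.1|exact: l5.1].
  by rewrite /Q linDr // !DZ ?addr0 //; [exact: l5.1|exact: D5|exact: l4.1|exact: D4].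
have par : parallel_form g D Q.
  move=> X Z p sX sZ; rewrite comp // DQ // (metric0l g_riemannian) ?add0r //.
  exact: sZ.1.
have [t1 t2 t3 t4 t5] : [/\ forall p, tangent p (e1 p), forall p, tangent p (e2 p),
    forall p, tangent p (e3 p), forall p, tangent p (e4 p) & forall p, tangent p (e5 p)].
  by split=> p; [exact: l1.1.1|exact: l2.1.1|exact: l3.1.1|exact: l4.1.1|exact: l5.1.1].
have Q_comb p w : tangent p w -> g p (Q p) w = q1 * g p (e4 p) w + q2 * g p (e5 p) w.
  move=> tw; rewrite -[Q p]/(q1 *: e4 p + q2 *: e5 p).
  have [tq4 tq5] := (tangent_scale q1 (t4 p), tangent_scale q2 (t5 p)).
  by rewrite (metricDl g_riemannian) // !(metricZl g_riemannian).
have Q_lt1 p : g p (Q p) (Q p) < 1.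
  rewrite Q_comb ?(metricC g_riemannian (v := Q p)) //; try exact: sQ.1.
  rewrite !Q_comb //.
  have := onE p (@Ordinal 5 3 isT) (@Ordinal 5 3 isT); have := onE p (@Ordinal 5 3 isT) (@Ordinal 5 4 isT).
  have := onE p (@Ordinal 5 4 isT) (@Ordinal 5 3 isT); have := onE p (@Ordinal 5 4 isT) (@Ordinal 5 4 isT).
  rewrite /E /= => -> -> -> ->; move: q_lt1; rewrite -[X in _ < X]sqrtr1 ltr_sqrt //.
  by rewrite !mulr0 !mulr1 add0r addr0 !expr2.
have A_tan : tangent one A by exact: P_subset.
have gAA : g one A A = 1.
  by rewrite -(sqr_sqrtr (metric_ge0 g_riemannian A_tan)) A_unit expr1n.
have EA (k : 'I_5) : g one (E k one) A = [:: a; b; c; d; f]`_k.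
  have := (onE one k (@Ordinal 5 0 isT), onE one k (@Ordinal 5 1 isT),
    onE one k (@Ordinal 5 2 isT), onE one k (@Ordinal 5 3 isT),
    onE one k (@Ordinal 5 4 isT)).
  rewrite A_def -/one => -[] [] [] [] o1 o2 o3 o4 o5.
  have tz (r : R) (X : vfield N) : (forall p, tangent p (X p)) -> tangent one (r *: X one).
    by move=> tX; exact: tangent_scale.
  have [ta tb tc] := And3 (tz a e1 t1) (tz b e2 t2) (tz c e3 t3).
  have [td tf] := conj (tz d e4 t4) (tz f e5 t5).
  have tk : tangent one (E k one) by exact: (sE k).1.
  rewrite !(metricDr g_riemannian) //; try by do ?apply: tangent_add.
  rewrite !(metricZr g_riemannian) //.
  move: o1 o2 o3 o4 o5; rewrite {2 4 6 8 10}/E /= => -> -> -> -> ->.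
  by case: k {tk} => -[|[|[|[|[|k]]]]] //= lt5; rewrite ?eqE /=; ring.
have FA : randers g Q one A = 1 + q1 * d + q2 * f.
  rewrite /randers A_unit Q_comb // -addrA; congr (_ + (_ * _ + _ * _)).
    exact: (EA (@Ordinal 5 3 isT)).
  exact: (EA (@Ordinal 5 4 isT)).
have PE : P = lin_span [:: A; B] by exact: AB_basis.1.
have value U Y : smooth_vfield U -> smooth_vfield Y -> nonvanishing Y ->
    Y one = A -> is_basis P [:: U one; Y one] ->
    let gY := fundamental_tensor (randers g Q) one (Y one) in
    gY (curvature (nab Y) U Y Y one) (U one) /
      (gY (Y one) (Y one) * gY (U one) (U one) - gY (Y one) (U one) ^+ 2) =
    KR / (1 + q1 * d + q2 * f) ^+ 2.
  move=> sU sY Y0 YA basUY /=.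
  have := randers_flag_quotient g_riemannian D_levi_civita sQ Q_lt1 par nab_chern
    (p := one) sU sY Y0.
  rewrite YA => /(_ gAA) /= ->; rewrite FA; congr (_ / _).
  suff : [set KR] (g one (curvature D U Y Y one) (U one) /
      (g one A A * g one (U one) (U one) - g one A (U one) ^+ 2)) by [].
  rewrite -KR_sectional; exists U, Y.
  by split=> //; [rewrite -PE|rewrite YA].
rewrite /is_flag_curvature -/Q; apply/seteqP; split=> [r [U [Y]]|r ->].
  by move=> [sU sY Y0 [YA basUY] ->]; exact: value.
pose Y : vfield N := a *: e1 + b *: e2 + c *: e3 + d *: e4 + f *: e5.
have lY : lie_algebra N Y by do ?apply: lie_algebraD; exact: lie_algebraZ.
have YA : Y one = A by rewrite A_def.
have Y0 : nonvanishing Y.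
  move=> p Yp0; have := left_invariant_metric_cst p g_left_invariant lY lY.
  rewrite -/one YA gAA Yp0 (metric0l g_riemannian); last exact: tangent0.
  by move=> /esym/eqP; rewrite oner_eq0.
(* The vector B is only assumed tangent. The fields that realise the sectional
   curvature span the plane at the unit, so a combination of them extends B. *)
have [U0 [V0 [sU0 sV0 basUV _]]] : exists U0 V0 : vfield N,
    [/\ smooth_vfield U0, smooth_vfield V0,
        is_basis (lin_span [:: A; B]) [:: U0 one; V0 one] &
        KR = g one (curvature D U0 V0 V0 one) (U0 one) /
          (g one (V0 one) (V0 one) * g one (U0 one) (U0 one) -
           g one (V0 one) (U0 one) ^+ 2)].
  by have : [set KR] KR by []; rewrite -KR_sectional.
have /lin_span2P[x [y BE]] : lin_span [:: U0 one; V0 one] B.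
  by rewrite -basUV.1 -PE.
pose U : vfield N := x *: U0 + y *: V0.
have sU : smooth_vfield U by apply: smooth_vfieldD; exact: smooth_vfieldZ.
have basUY : is_basis P [:: U one; Y one].
  by rewrite YA -[U one]/(x *: U0 one + y *: V0 one) -BE; exact: is_basis2C.
exists U, Y; split=> //; first exact: lY.1.
by rewrite (value U Y) //; exact: lY.1.
Qed.
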